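(* For a $\delta$-invertible morphism $\Phi\colon V\to W$ of persistence modules with $\delta<\frac12\min(\Xi(V),\Xi(W))$ there exist parameters $r_{J_1}^{J_2}, d_J^+, d_K^-\in\mathbb{N}$ such that $$(V,W,\Phi)\;\cong\;\bigoplus_{J_1\preceq J_2}\big(\mathbf{R}_{J_1}^{J_2}\big)^{r_{J_1}^{J_2}}\;\oplus\;\bigoplus_{J}\big(\mathbf{I}^+_J\big)^{d_J^+}\;\oplus\;\bigoplus_{K}\big(\mathbf{I}^-_K\big)^{d_K^-}.$$
   Context: Fix a field $\mathbb{F}$ and a finite totally ordered index set $\{0,1,\dots,l\}$, $l\in\mathbb{N}$. Here $\mathbb{N}$ includes $0$. A persistence module $V$ is a functor from $\{0,1,\dots,l\}$ (viewed as a category) to $\mathbb{F}$-vector spaces with every $V_i$ finite dimensional; its inner morphisms are the linear maps $v_{i,j}\colon V_i\to V_j$, $i\le j$. Every such $V$ is isomorphic to a direct sum of interval modules $k_J$, where $J=[i,j]$ is an interval in $\{0,\dots,l\}$ and $k_J$ is $\mathbb{F}$ at indices in $J$, $0$ elsewhere, with identity inner morphisms inside $J$. The multiset of intervals in this decomposition is the barcode $\mathbf{Bar}(V)$; its elements are bars. A morphism $\Phi\colon V\to W$ is a family of linear maps $\Phi_i\colon V_i\to W_i$ commuting with the inner morphisms. The shift $V(\delta)$ by a parameter $\delta\ge 0$ is given by $V(\delta)_t=V_{t+\delta}$, $v(\delta)_{t_1,t_2}=v_{t_1+\delta,t_2+\delta}$, where $V_s$ is understood to be $0$ for $s<0$ or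 $s>l$. A morphism $\Phi\colon V\to W$ is $\delta$-invertible if there is a morphism $\Psi\colon W\to V(2\delta)$ (a $\delta$-inverse) with $\Psi_t\circ\Phi_t=v_{t,t+2\delta}$ and $\Phi_{t+2\delta}\circ\Psi_t=w_{t,t+2\delta}$ for all $t$. Relations on intervals: $[i_1,j_1]\preceq[i_2,j_2]$ iff $i_1\le i_2\le j_1\le j_2$; $[i_1,j_1]\subset[i_2,j_2]$ (strictly nested) iff $i_2<i_1\le j_1<j_2$. Nestedness: $\Xi(V)=\min\{\min(|a-c|,|b-d|) : [a,b]\subset[c,d],\ [a,b],[c,d]\in\mathbf{Bar}(V)\}\in(0,\infty]$, equal to $\infty$ if there are no strictly nested bars. The morphism $\Phi\colon V\to W$ is viewed as a ladder persistence module $(V,W,\Phi)$, i.e. the commutative diagram formed by $V$, $W$ and the maps $\Phi_i$; an isomorphism $(V,W,\Phi)\cong(V',W',\Phi')$ is a pair of isomorphisms $V\cong V'$, $W\cong W'$ commuting with $\Phi,\Phi'$; direct sums are taken componentwise. Elementary ladder modules: for $J_1\preceq J_2$, $\mathbf{R}_{J_1}^{J_2}=(k_{J_2},k_{J_1},\rho)$ with $\rho_t=\mathrm{id}$ for $t\in J_1\cap J_2$ and $\rho_t=0$ otherwise; $\mathbf{I}^+_J=(k_J,0,0)$; $\mathbf{I}^-_K=(0,k_K,0)$. In the decomposition $J_1,J_2,J,K$ range over intervals in $\{0,\dots,l\}$. *)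

(* Defs.v *)
From HB Require Import structures.
From mathcomp Require Export all_boot all_order all_algebra.
From mathcomp Require Export finmap multiset.
From mathcomp Require Export boolp classical_sets constructive_ereal.

Set Implicit Arguments.
Unset Strict Implicit.
Unset Printing Implicit Defensive.

Import Order.TTheory GRing.Theory Num.Theory.
Local Open Scope ring_scope.

(* Functors from the poset {0, ..., l} to finite-dimensional F-vector spaces. *)
Record persmod (F : fieldType) (l : nat) := PersMod {
  pm_obj :> 'I_l.+1 -> vectType F;
  pm_map : forall i j : 'I_l.+1, (i <= j)%N -> 'Hom(pm_obj i, pm_obj j);
  pm_id : forall (i : 'I_l.+1) (h : (i <= i)%N), pm_map h = \1%VF;
  pm_comp : forall (i j k : 'I_l.+1)
      (hij : (i <= j)%N) (hjk : (j <= k)%N) (hik : (i <= k)%N),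
    (pm_map hjk \o pm_map hij)%VF = pm_map hik
}.
Arguments pm_map {F l} p {i j} h.

Record pm_mor (F : fieldType) (l : nat) (V W : persmod F l) := PmMor {
  mor_map :> forall i : 'I_l.+1, 'Hom(V i, W i);
  mor_natural : forall (i j : 'I_l.+1) (h : (i <= j)%N),
    (mor_map j \o pm_map V h)%VF = (pm_map W h \o mor_map i)%VF
}.

Definition is_iso (F : fieldType) (l : nat) (V W : persmod F l)
    (f : pm_mor V W) : Prop :=
  exists g : pm_mor W V, forall i : 'I_l.+1,
    (g i \o f i)%VF = \1%VF /\ (f i \o g i)%VF = \1%VF.

Definition pm_iso (F : fieldType) (l : nat) (V W : persmod F l) : Prop :=
  exists f : pm_mor V W, is_iso f.

(* Extension of V by 0 beyond l: [None : option 'I_l.+1] stands for any index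
   s > l, and [insub s] sends s : nat to its place in the extended index set. *)
Definition ext_obj (F : fieldType) (l : nat) (V : persmod F l)
    (o : option 'I_l.+1) : vectType F :=
  if o is Some i then V i else 'rV[F]_0.

Definition ext_le (l : nat) (o1 o2 : option 'I_l.+1) : bool :=
  match o1, o2 with
  | _, None => true
  | None, Some _ => false
  | Some i, Some j => (i <= j)%N
  end.

Definition ext_map (F : fieldType) (l : nat) (V : persmod F l)
    (o1 o2 : option 'I_l.+1) :
    ext_le o1 o2 -> 'Hom(ext_obj V o1, ext_obj V o2) :=
  match o1, o2 with
  | Some i, Some j => fun h => pm_map V h
  | _, _ => fun _ => 0
  end.

Lemma ext_map_id (F : fieldType) (l : nat) (V : persmod F l)
    (o : option 'I_l.+1) (h : ext_le o o) : ext_map V h = \1%VF.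
Proof.
case: o h => [i|] h /=; first exact: pm_id.
by apply/lfunP => x; rewrite [x]thinmx0 !linear0.
Qed.

Lemma ext_map_comp (F : fieldType) (l : nat) (V : persmod F l)
    (o1 o2 o3 : option 'I_l.+1)
    (h12 : ext_le o1 o2) (h23 : ext_le o2 o3) (h13 : ext_le o1 o3) :
  (ext_map V h23 \o ext_map V h12)%VF = ext_map V h13.
Proof.
case: o1 o2 o3 h12 h23 h13 => [i|] [j|] [k|] //= h12 h23 h13;
  by rewrite ?comp_lfun0r ?comp_lfun0l //; apply: pm_comp.
Qed.

Lemma ext_le_shift (l n : nat) (i j : 'I_l.+1) : (i <= j)%N ->
  ext_le (insub (i + n)%N : option 'I_l.+1) (insub (j + n)%N).
Proof.
move=> hij; case: insubP => [i' _ ei|]; case: insubP => [j' _ ej|] //=.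
  by rewrite ei ej leq_add2r.
by rewrite (@leq_ltn_trans j') // ej leq_add2r.
Qed.

Lemma ext_le_trans (l n : nat) (i : 'I_l.+1) :
  ext_le (Some i) (insub (i + n)%N).
Proof. by case: insubP => //= j _ ->; rewrite leq_addr. Qed.

Definition shift (F : fieldType) (l n : nat) (V : persmod F l) : persmod F l :=
  @PersMod F l (fun i => ext_obj V (insub (i + n)%N))
    (fun i j h => ext_map V (ext_le_shift n h))
    (fun i h => ext_map_id V (ext_le_shift n h))
    (fun i j k hij hjk hik => ext_map_comp V (ext_le_shift n hij)
       (ext_le_shift n hjk) (ext_le_shift n hik)).

(* The inner morphism v_{i,i+n} : V_i -> V_{i+n} = V(n)_i. *)
Definition trans (F : fieldType) (l n : nat) (V : persmod F l) (i : 'I_l.+1) :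
    'Hom(V i, shift n V i) :=
  ext_map V (ext_le_trans n i).

Definition ext_mor (F : fieldType) (l : nat) (V W : persmod F l)
    (f : pm_mor V W) (o : option 'I_l.+1) : 'Hom(ext_obj V o, ext_obj W o) :=
  match o with Some i => f i | None => 0 end.

(* The map f_{i+n} : V_{i+n} -> W_{i+n}, which is 0 when i + n > l. *)
Definition shift_mor (F : fieldType) (l n : nat) (V W : persmod F l)
    (f : pm_mor V W) (i : 'I_l.+1) : 'Hom(shift n V i, shift n W i) :=
  ext_mor f (insub (i + n)%N).

(* Only the shift by 2 delta enters, and it makes sense on the index set
   {0, ..., l} exactly when 2 delta is a natural number n. *)
Definition delta_invertible (F : fieldType) (l : nat) (V W : persmod F l)
    (delta : rat) (Phi : pm_mor V W) : Prop :=
  exists2 n : nat, n%:R = 2 * delta &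
  exists Psi : pm_mor W (shift n V), forall i : 'I_l.+1,
    (Psi i \o Phi i)%VF = trans n V i /\
    (shift_mor n Phi i \o Psi i)%VF = trans n W i.

Definition interval (l : nat) : Type :=
  {p : 'I_l.+1 * 'I_l.+1 | (p.1 <= p.2)%N}.
HB.instance Definition _ (l : nat) := Finite.on (interval l).

Definition lo (l : nat) (J : interval l) : 'I_l.+1 := (val J).1.
Definition hi (l : nat) (J : interval l) : 'I_l.+1 := (val J).2.

Definition in_interval (l : nat) (J : interval l) (i : 'I_l.+1) : bool :=
  (lo J <= i <= hi J)%N.

Definition preceq (l : nat) (J1 J2 : interval l) : bool :=
  [&& lo J1 <= lo J2, lo J2 <= hi J1 & hi J1 <= hi J2]%N.

Definition nested (l : nat) (J1 J2 : interval l) : bool :=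
  [&& lo J2 < lo J1, lo J1 <= hi J1 & hi J1 < hi J2]%N.

Definition preceq_pair (l : nat) : Type :=
  {p : interval l * interval l | preceq p.1 p.2}.
HB.instance Definition _ (l : nat) := Finite.on (preceq_pair l).

(* [fib F b] is F if b holds and 0 otherwise; [fib_map F b1 b2] is the
   identity of F if both ends are F and 0 otherwise. *)
Definition fib (F : fieldType) (b : bool) : vectType F :=
  if b then (F^o : vectType F) else ('rV[F]_0 : vectType F).

Definition fib_map (F : fieldType) (b1 b2 : bool) : 'Hom(fib F b1, fib F b2) :=
  match b1, b2 with
  | true, true => \1%VF
  | _, _ => 0
  end.

Lemma fib_map_id (F : fieldType) (b : bool) : fib_map F b b = \1%VF.
Proof.
by case: b => //=; apply/lfunP => x; rewrite [x]thinmx0 !linear0.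
Qed.

Lemma fib_map_comp (F : fieldType) (b1 b2 b3 : bool) :
  (b1 -> b3 -> b2) ->
  (fib_map F b2 b3 \o fib_map F b1 b2)%VF = fib_map F b1 b3.
Proof.
case: b1 b2 b3 => [] [] [] //= h; rewrite ?comp_lfun0r ?comp_lfun0l //.
  by rewrite comp_lfun1l.
by have := h isT isT.
Qed.

Lemma in_interval_convex (l : nat) (J : interval l) (i j k : 'I_l.+1) :
  (i <= j)%N -> (j <= k)%N ->
  in_interval J i -> in_interval J k -> in_interval J j.
Proof.
move=> hij hjk /andP[h1 _] /andP[_ h2].
by rewrite /in_interval (leq_trans h1 hij) (leq_trans hjk h2).
Qed.

Definition interval_module (F : fieldType) (l : nat) (J : interval l) :
    persmod F l :=
  @PersMod F l (fun i => fib F (in_interval J i))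
    (fun i j _ => fib_map F (in_interval J i) (in_interval J j))
    (fun i _ => fib_map_id F (in_interval J i))
    (fun i j k hij hjk _ => fib_map_comp F (in_interval_convex hij hjk)).

Definition pm_zero (F : fieldType) (l : nat) : persmod F l.
Proof.
by refine (@PersMod F l (fun=> 'rV[F]_0) (fun i j _ => \1%VF) _ _) => *;
  rewrite ?comp_lfun1l.
Defined.

Section PairMap.
Variables (F : fieldType) (A B C D : vectType F).
Variables (f : 'Hom(A, C)) (g : 'Hom(B, D)).

Definition pair_fun (p : A * B) : C * D := (f p.1, g p.2).

Lemma pair_fun_linear : linear pair_fun.
Proof. by move=> a p q; rewrite /pair_fun /= !linearP. Qed.

HB.instance Definition _ :=
  GRing.isLinear.Build F (A * B)%type (C * D)%type _ pair_fun pair_fun_linear.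

Definition pair_map : 'Hom((A * B)%type, (C * D)%type) := linfun pair_fun.

Lemma pair_mapE (p : A * B) : pair_map p = (f p.1, g p.2).
Proof. by rewrite lfunE. Qed.
End PairMap.

Lemma pair_map_id (F : fieldType) (A B : vectType F) :
  pair_map (\1%VF : 'End(A)) (\1%VF : 'End(B)) = \1%VF.
Proof. by apply/lfunP => -[x y]; rewrite pair_mapE !id_lfunE. Qed.

Lemma pair_map_comp (F : fieldType) (A B C A' B' C' : vectType F)
    (f : 'Hom(A, B)) (f2 : 'Hom(B, C)) (g : 'Hom(A', B')) (g2 : 'Hom(B', C')) :
  (pair_map f2 g2 \o pair_map f g)%VF =
  pair_map (f2 \o f)%VF (g2 \o g)%VF.
Proof. by apply/lfunP => x; rewrite comp_lfunE !pair_mapE !comp_lfunE. Qed.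

Definition pm_sum (F : fieldType) (l : nat) (V W : persmod F l) : persmod F l.
Proof.
refine (@PersMod F l (fun i => (V i * W i)%type)
  (fun i j h => pair_map (pm_map V h) (pm_map W h)) _ _) => [i h|i j k hij hjk hik].
  by rewrite !pm_id pair_map_id.
by rewrite pair_map_comp (pm_comp V hij hjk hik) (pm_comp W hij hjk hik).
Defined.

Definition pm_pow (F : fieldType) (l : nat) (V : persmod F l) (n : nat) :
    persmod F l :=
  iter n (pm_sum V) (pm_zero F l).

Definition is_barcode (F : fieldType) (l : nat) (V : persmod F l)
    (B : {mset interval l}%mset) : Prop :=
  pm_iso V (\big[@pm_sum F l / pm_zero F l]_(J : interval l)
              pm_pow (interval_module F J) (B J)).

(* The barcode exists and is unique, so neither the choice made by [xget] nor
   its default value matters. *)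
Definition Bar (F : fieldType) (l : nat) (V : persmod F l) :
    {mset interval l}%mset :=
  xget mset0 [set B | is_barcode V B]%classic.

Definition nest_gap (l : nat) (J1 J2 : interval l) : rat :=
  Num.min `|(lo J1)%:R - (lo J2)%:R| `|(hi J1)%:R - (hi J2)%:R|.

Definition Xi (F : fieldType) (l : nat) (V : persmod F l) : \bar rat :=
  (\big[Order.min / +oo]_(p : interval l * interval l |
      [&& p.1 \in Bar V, p.2 \in Bar V & nested p.1 p.2])
    (nest_gap p.1 p.2)%:E)%E.

Record ladder (F : fieldType) (l : nat) := Ladder {
  lad_dom : persmod F l;
  lad_cod : persmod F l;
  lad_mor : pm_mor lad_dom lad_cod
}.
Arguments Ladder {F l} [lad_dom lad_cod] lad_mor.

Definition lad_iso (F : fieldType) (l : nat) (L M : ladder F l) : Prop :=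
  exists (f : pm_mor (lad_dom L) (lad_dom M))
         (g : pm_mor (lad_cod L) (lad_cod M)),
    [/\ is_iso f, is_iso g &
        forall i : 'I_l.+1, (lad_mor M i \o f i)%VF = (g i \o lad_mor L i)%VF].

Definition zero_mor (F : fieldType) (l : nat) (V W : persmod F l) : pm_mor V W.
Proof.
by refine (@PmMor F l V W (fun=> 0) _) => *; rewrite comp_lfun0l comp_lfun0r.
Defined.

Definition sum_mor (F : fieldType) (l : nat) (V W V' W' : persmod F l)
    (f : pm_mor V W) (f' : pm_mor V' W') :
    pm_mor (pm_sum V V') (pm_sum W W').
Proof.
refine (@PmMor F l (pm_sum V V') (pm_sum W W')
          (fun i => pair_map (f i) (f' i)) _) => i j h /=.
by rewrite !pair_map_comp !mor_natural.
Defined.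

Definition lad_zero (F : fieldType) (l : nat) : ladder F l :=
  Ladder (zero_mor (pm_zero F l) (pm_zero F l)).

Definition lad_sum (F : fieldType) (l : nat) (L M : ladder F l) : ladder F l :=
  Ladder (sum_mor (lad_mor L) (lad_mor M)).

Definition lad_pow (F : fieldType) (l : nat) (L : ladder F l) (n : nat) :
    ladder F l :=
  iter n (lad_sum L) (lad_zero F l).

Definition rho (F : fieldType) (l : nat) (J1 J2 : interval l)
    (h : preceq J1 J2) :
  pm_mor (interval_module F J2) (interval_module F J1).
Proof.
refine (@PmMor F l (interval_module F J2) (interval_module F J1)
  (fun i => fib_map F (in_interval J2 i) (in_interval J1 i)) _) => i j hij /=.
case/and3P: h => h1 h2 h3.
rewrite !fib_map_comp // /in_interval.
  by move=> /andP[a b] /andP[c d]; rewrite (leq_trans h1 a) (leq_trans hij d).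
move=> /andP[a b] /andP[c d].
by rewrite (leq_trans a hij) (leq_trans d h3).
Defined.

Definition lad_R (F : fieldType) (l : nat) (J1 J2 : interval l)
    (h : preceq J1 J2) : ladder F l :=
  Ladder (rho F h).

Definition lad_Iplus (F : fieldType) (l : nat) (J : interval l) : ladder F l :=
  Ladder (zero_mor (interval_module F J) (pm_zero F l)).

Definition lad_Iminus (F : fieldType) (l : nat) (K : interval l) : ladder F l :=
  Ladder (zero_mor (pm_zero F l) (interval_module F K)).

Definition lad_bigsum (F : fieldType) (l : nat) (I : finType)
    (L : I -> ladder F l) : ladder F l :=
  \big[@lad_sum F l / lad_zero F l]_(i : I) L i.

(* Main.v *)
(* Call k_J a summand of V when it is a retract of V. Choose decompositions of V
   and W into interval modules and regard Phi as a matrix whose (K, J) entry is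
   a scalar multiple of the map k_J -> k_K, and vanishes unless K <= J in the
   order of intervals. Two intersecting bars of the same module that are not
   comparable are strictly nested, with both gaps larger than n = 2 delta; the
   outer one is then longer than n, so the composites of Phi with its inverse
   up to shift force a nonzero entry of Phi that matches it with a bar whose
   endpoints differ by at most n. Hence, if K0 is the nonzero row with largest
   (hi, lo) and J0 the column of smallest (lo, hi) with a nonzero entry in row
   K0, all bars J meeting row K0 satisfy J0 <= J and all bars K meeting column
   J0 satisfy K <= K0. Then R_{K0}^{J0} is a retract of the ladder; its
   complement satisfies the same hypotheses and has smaller dimension. Once
   Phi = 0 the summands of V and W split off one by one. *)
From HB Require Import structures.
Require Import Defs.
From mathcomp Require Import zify lra.
Import Order.TTheory GRing.Theory Num.Theory.

Set Implicit Arguments.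
Unset Strict Implicit.
Unset Printing Implicit Defensive.
Local Open Scope ring_scope.

(** * Morphisms and their isomorphisms *)

Section LinearFunctions.
Variables (F : fieldType) (U V : vectType F).

Definition lfun_of (f : U -> V) (Hf : linear f) : 'Hom(U, V) :=
  let m := GRing.isLinear.Build F U V _ f Hf in
  let f' : {linear U -> V} := HB.pack f m in linfun f'.

Lemma lfun_ofE (f : U -> V) (Hf : linear f) x : lfun_of Hf x = f x.
Proof. by rewrite /lfun_of lfunE. Qed.

Lemma lfunD (f : 'Hom(U, V)) x y : f (x + y) = f x + f y.
Proof. exact: linearD. Qed.

Lemma lfunB (f : 'Hom(U, V)) x y : f (x - y) = f x - f y.
Proof. exact: linearB. Qed.

Lemma lfunZ (f : 'Hom(U, V)) c x : f (c *: x) = c *: f x.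
Proof. exact: linearZ. Qed.

Lemma lfun0 (f : 'Hom(U, V)) : f 0 = 0.
Proof. exact: linear0. Qed.

Lemma lfun_sum (f : 'Hom(U, V)) (A : finType) (x : A -> U) :
  f (\sum_a x a) = \sum_a f (x a).
Proof. exact: linear_sum. Qed.

Lemma lfun_neq0P (f : 'Hom(U, V)) : f != 0 -> exists x, f x != 0.
Proof.
apply: contra_neqP => H; apply/lfunP => x; rewrite zero_lfunE.
by apply/eqP/negPn/negP => Hx; apply: H; exists x.
Qed.

End LinearFunctions.

(** A nonzero vector is a free family of length one, and its coordinate function is the required
    functional. *)
Lemma exists_dual (F : fieldType) (V : vectType F) (y : V) :
  y != 0 -> exists f : 'Hom(V, F^o), f y = 1.
Proof.
rewrite -seq1_free => Hy.
exists (linfun (coord [tuple y] ord0 : V -> F^o)); rewrite lfunE /=.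
by have := @coord_free _ _ _ [tuple y] ord0 ord0 Hy; rewrite eqxx.
Qed.

Section Morphisms.
Variables (F : fieldType) (l : nat).
Implicit Types (V W X : persmod F l) (i j k : 'I_l.+1).

Lemma mor_naturalE V W (f : pm_mor V W) i j (h : (i <= j)%N) x :
  f j (pm_map V h x) = pm_map W h (f i x).
Proof. by have /lfunP/(_ x) := mor_natural f h; rewrite !comp_lfunE. Qed.

Lemma pm_idE V i (h : (i <= i)%N) x : pm_map V h x = x.
Proof. by rewrite pm_id id_lfunE. Qed.

Lemma pm_compE V i j k (hij : (i <= j)%N) (hjk : (j <= k)%N)
    (hik : (i <= k)%N) x :
  pm_map V hjk (pm_map V hij x) = pm_map V hik x.
Proof. by rewrite -(pm_comp V hij hjk hik) comp_lfunE. Qed.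

Lemma pm_map_irr V i j (h h' : (i <= j)%N) : pm_map V h = pm_map V h'.
Proof. by rewrite (bool_irrelevance h h'). Qed.

(** Naturality is asked pointwise. The definition is transparent, so the component at [i] reduces to
    [f i]. *)
Definition mk_mor V W (f : forall i : 'I_l.+1, 'Hom(V i, W i))
    (H : forall (i j : 'I_l.+1) (h : (i <= j)%N) x,
      f j (pm_map V h x) = pm_map W h (f i x)) : pm_mor V W.
Proof.
by exists f => i j h; apply/lfunP => x; rewrite !comp_lfunE.
Defined.

Definition id_mor V : pm_mor V V.
Proof. by refine (@mk_mor V V (fun=> \1%VF) _) => *; rewrite !id_lfunE. Defined.

Lemma id_morE V i x : id_mor V i x = x.
Proof. exact: id_lfunE. Qed.

Definition comp_mor V W X (g : pm_mor W X) (f : pm_mor V W) : pm_mor V X.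
Proof.
refine (@mk_mor V X (fun i => g i \o f i)%VF _) => i j h x.
by rewrite !comp_lfunE /= !mor_naturalE.
Defined.

Lemma comp_morE V W X (g : pm_mor W X) (f : pm_mor V W) i x :
  comp_mor g f i x = g i (f i x).
Proof. exact: comp_lfunE. Qed.

Definition lincomb_mor V W (A : finType) (c : A -> F)
    (f : A -> pm_mor V W) : pm_mor V W.
Proof.
refine (@mk_mor V W (fun i => \sum_a c a *: f a i) _) => i j h x.
rewrite !sum_lfunE linear_sum; apply: eq_bigr => a _.
by rewrite !scale_lfunE linearZ /= mor_naturalE.
Defined.

Lemma lincomb_morE V W (A : finType) (c : A -> F) (f : A -> pm_mor V W) i x :
  lincomb_mor c f i x = \sum_a c a *: f a i x.
Proof.
by rewrite sum_lfunE; apply: eq_bigr => a _; rewrite scale_lfunE.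
Qed.

Lemma zero_morE V W i x : zero_mor V W i x = 0.
Proof. exact: zero_lfunE. Qed.

Lemma pm_sum_mapE V W i j (h : (i <= j)%N) x :
  pm_map (pm_sum V W) h x = (pm_map V h x.1, pm_map W h x.2).
Proof. exact: pair_mapE. Qed.

Lemma pair_linear (U V W : vectType F) (f : 'Hom(U, V)) (g : 'Hom(U, W)) :
  linear (fun x => (f x, g x)).
Proof. by move=> a x y /=; rewrite !linearP. Qed.

Definition pair_mor V W X (f : pm_mor X V) (g : pm_mor X W) :
  pm_mor X (pm_sum V W).
Proof.
refine (@mk_mor X (pm_sum V W)
  (fun i => lfun_of (pair_linear (f i) (g i))) _) => i j h x.
by rewrite pm_sum_mapE !lfun_ofE !mor_naturalE.
Defined.

Lemma pair_morE V W X (f : pm_mor X V) (g : pm_mor X W) i x :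
  pair_mor f g i x = (f i x, g i x).
Proof. exact: lfun_ofE. Qed.

Lemma fst_linear (U V : vectType F) : linear (fun x : U * V => x.1).
Proof. by []. Qed.

Definition fst_mor V W : pm_mor (pm_sum V W) V.
Proof.
refine (@mk_mor (pm_sum V W) V
  (fun i => lfun_of (@fst_linear (V i) (W i))) _) => i j h x.
by rewrite pm_sum_mapE !lfun_ofE.
Defined.

Lemma fst_morE V W i (x : pm_sum V W i) : fst_mor V W i x = x.1.
Proof. exact: lfun_ofE. Qed.

Lemma snd_linear (U V : vectType F) : linear (fun x : U * V => x.2).
Proof. by []. Qed.

Definition snd_mor V W : pm_mor (pm_sum V W) W.
Proof.
refine (@mk_mor (pm_sum V W) W
  (fun i => lfun_of (@snd_linear (V i) (W i))) _) => i j h x.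
by rewrite pm_sum_mapE !lfun_ofE.
Defined.

Lemma snd_morE V W i (x : pm_sum V W i) : snd_mor V W i x = x.2.
Proof. exact: lfun_ofE. Qed.

Definition inl_mor V W : pm_mor V (pm_sum V W) :=
  pair_mor (id_mor V) (zero_mor V W).

Lemma inl_morE V W i x : inl_mor V W i x = (x, 0).
Proof. by rewrite pair_morE id_morE zero_morE. Qed.

Definition inr_mor V W : pm_mor W (pm_sum V W) :=
  pair_mor (zero_mor W V) (id_mor W).

Lemma inr_morE V W i x : inr_mor V W i x = (0, x).
Proof. by rewrite pair_morE id_morE zero_morE. Qed.

Lemma sum_morE V W V' W' (f : pm_mor V W) (f' : pm_mor V' W') i x :
  sum_mor f f' i x = (f i x.1, f' i x.2).
Proof. by rewrite /= pair_mapE. Qed.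

Definition morE := (id_morE, comp_morE, zero_morE, inl_morE, inr_morE,
  pair_morE, fst_morE, snd_morE, sum_morE).

Lemma is_isoP V W (f : pm_mor V W) (g : pm_mor W V) :
  (forall i x, g i (f i x) = x) -> (forall i x, f i (g i x) = x) -> is_iso f.
Proof.
by move=> fK gK; exists g => i; split; apply/lfunP => x;
  rewrite comp_lfunE id_lfunE.
Qed.

Lemma is_isoE V W (f : pm_mor V W) : is_iso f ->
  exists g : pm_mor W V,
    (forall i x, g i (f i x) = x) /\ (forall i x, f i (g i x) = x).
Proof.
case=> g H; exists g; split=> i x; have [H1 H2] := H i.
  by have /lfunP/(_ x) := H1; rewrite comp_lfunE id_lfunE.
by have /lfunP/(_ x) := H2; rewrite comp_lfunE id_lfunE.
Qed.

Lemma is_iso_id V : is_iso (id_mor V).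
Proof. by apply: (@is_isoP _ _ _ (id_mor V)) => i x; rewrite !morE. Qed.

Lemma is_iso_comp V W X (g : pm_mor W X) (f : pm_mor V W) :
  is_iso f -> is_iso g -> is_iso (comp_mor g f).
Proof.
move=> /is_isoE[f' [fK f'K]] /is_isoE[g' [gK g'K]].
by apply: (@is_isoP _ _ _ (comp_mor f' g')) => i x;
  rewrite !morE ?gK ?fK ?f'K ?g'K.
Qed.

Lemma is_iso_sum V W V' W' (f : pm_mor V W) (f' : pm_mor V' W') :
  is_iso f -> is_iso f' -> is_iso (sum_mor f f').
Proof.
move=> /is_isoE[g [fK gK]] /is_isoE[g' [f'K g'K]].
by apply: (@is_isoP _ _ _ (sum_mor g g')) => i [x y];
  rewrite !morE /= ?fK ?gK ?f'K ?g'K.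
Qed.

Definition assoc_mor V W X :
    pm_mor (pm_sum V (pm_sum W X)) (pm_sum (pm_sum V W) X) :=
  let s := snd_mor V (pm_sum W X) in
  pair_mor (pair_mor (fst_mor V _) (comp_mor (fst_mor W X) s))
    (comp_mor (snd_mor W X) s).

Lemma assoc_morE V W X i x :
  assoc_mor V W X i x = ((x.1, x.2.1), x.2.2).
Proof. by rewrite !morE. Qed.

Lemma is_iso_assoc V W X : is_iso (assoc_mor V W X).
Proof.
pose s := fst_mor (pm_sum V W) X.
apply: (@is_isoP _ _ _ (pair_mor (comp_mor (fst_mor V W) s)
   (pair_mor (comp_mor (snd_mor V W) s) (snd_mor _ X)))) => i.
  by case=> [x [y z]]; rewrite assoc_morE !morE.
by case=> [[x y] z]; rewrite assoc_morE !morE.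
Qed.

Definition swap_mor V W : pm_mor (pm_sum V W) (pm_sum W V) :=
  pair_mor (snd_mor V W) (fst_mor V W).

Lemma swap_morE V W i x : swap_mor V W i x = (x.2, x.1).
Proof. by rewrite !morE. Qed.

Lemma is_iso_swap V W : is_iso (swap_mor V W).
Proof.
by apply: (@is_isoP _ _ _ (swap_mor W V)) => i [x y]; rewrite !swap_morE.
Qed.

Lemma pm_zero_eq0 i (x : pm_zero F l i) : x = 0.
Proof. exact: thinmx0. Qed.

Lemma is_iso_snd0 V : is_iso (snd_mor (pm_zero F l) V).
Proof.
apply: (@is_isoP _ _ _ (inr_mor _ V)) => i x; rewrite !morE //.
by case: x => [x y]; rewrite (pm_zero_eq0 x).
Qed.

Lemma is_iso_to0 V : (forall i (x : V i), x = 0) ->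
  is_iso (zero_mor V (pm_zero F l)).
Proof.
move=> V0; apply: (@is_isoP _ _ _ (zero_mor _ V)) => i x; rewrite !morE.
  by rewrite [RHS]V0.
by rewrite [RHS]pm_zero_eq0.
Qed.

Lemma pm_iso_refl V : pm_iso V V.
Proof. by exists (id_mor V); apply: is_iso_id. Qed.

Lemma pm_iso_sym V W : pm_iso V W -> pm_iso W V.
Proof.
by case=> f /is_isoE[g [fK gK]]; exists g; apply: (@is_isoP _ _ _ f).
Qed.

Lemma pm_iso_trans V W X : pm_iso V W -> pm_iso W X -> pm_iso V X.
Proof.
by case=> f Hf [g Hg]; exists (comp_mor g f); apply: is_iso_comp.
Qed.

Lemma pm_iso_sum V W V' W' :
  pm_iso V W -> pm_iso V' W' -> pm_iso (pm_sum V V') (pm_sum W W').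
Proof.
by case=> f Hf [g Hg]; exists (sum_mor f g); apply: is_iso_sum.
Qed.

Lemma pm_iso_assoc V W X :
  pm_iso (pm_sum V (pm_sum W X)) (pm_sum (pm_sum V W) X).
Proof. by exists (assoc_mor V W X); apply: is_iso_assoc. Qed.

Lemma pm_iso_swap V W : pm_iso (pm_sum V W) (pm_sum W V).
Proof. by exists (swap_mor V W); apply: is_iso_swap. Qed.

Lemma pm_iso_add0 V : pm_iso (pm_sum (pm_zero F l) V) V.
Proof. by exists (snd_mor _ V); apply: is_iso_snd0. Qed.

End Morphisms.

(** * Isomorphisms and direct sums of ladders *)

Section Ladders.
Variables (F : fieldType) (l : nat).
Implicit Types L M N : ladder F l.

Lemma lad_isoP L M (f : pm_mor (lad_dom L) (lad_dom M))
    (g : pm_mor (lad_cod L) (lad_cod M)) :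
  is_iso f -> is_iso g ->
  (forall i x, lad_mor M i (f i x) = g i (lad_mor L i x)) -> lad_iso L M.
Proof.
move=> Hf Hg H; exists f, g; split=> // i.
by apply/lfunP => x; rewrite !comp_lfunE.
Qed.

Lemma lad_isoE L M : lad_iso L M ->
  exists (f : pm_mor (lad_dom L) (lad_dom M))
         (g : pm_mor (lad_cod L) (lad_cod M)),
  [/\ is_iso f, is_iso g &
      forall i x, lad_mor M i (f i x) = g i (lad_mor L i x)].
Proof.
case=> f [g [Hf Hg H]]; exists f, g; split=> // i x.
by have /lfunP/(_ x) := H i; rewrite !comp_lfunE.
Qed.

Lemma lad_iso_refl L : lad_iso L L.
Proof.
by apply: (lad_isoP (is_iso_id _) (is_iso_id _)) => i x; rewrite !morE.
Qed.

Lemma lad_iso_sym L M : lad_iso L M -> lad_iso M L.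
Proof.
move=> /lad_isoE[f [g [/is_isoE[f' [fK f'K]] /is_isoE[g' [gK g'K]] H]]].
apply: (lad_isoP (is_isoP f'K fK) (is_isoP g'K gK)) => i x.
by rewrite -{2}(f'K i x) H gK.
Qed.

Lemma lad_iso_trans L M N : lad_iso L M -> lad_iso M N -> lad_iso L N.
Proof.
move=> /lad_isoE[f [g [Hf Hg H]]] /lad_isoE[f' [g' [Hf' Hg' H']]].
apply: (lad_isoP (is_iso_comp Hf Hf') (is_iso_comp Hg Hg')) => i x.
by rewrite !morE H' H.
Qed.

Lemma lad_iso_sum L M L' M' :
  lad_iso L M -> lad_iso L' M' -> lad_iso (lad_sum L L') (lad_sum M M').
Proof.
move=> /lad_isoE[f [g [Hf Hg H]]] /lad_isoE[f' [g' [Hf' Hg' H']]].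
apply: (@lad_isoP (lad_sum L L') (lad_sum M M') _ _
  (is_iso_sum Hf Hf') (is_iso_sum Hg Hg')) => i x.
by rewrite !morE /= H H'.
Qed.

Lemma lad_iso_assoc L M N :
  lad_iso (lad_sum L (lad_sum M N)) (lad_sum (lad_sum L M) N).
Proof.
apply: (@lad_isoP (lad_sum L (lad_sum M N)) (lad_sum (lad_sum L M) N) _ _
  (is_iso_assoc _ _ _) (is_iso_assoc _ _ _)) => i x.
by rewrite !assoc_morE !morE.
Qed.

Lemma lad_iso_swap L M : lad_iso (lad_sum L M) (lad_sum M L).
Proof.
apply: (@lad_isoP (lad_sum L M) (lad_sum M L) _ _
  (is_iso_swap _ _) (is_iso_swap _ _)) => i x.
by rewrite !swap_morE !morE.
Qed.

Lemma lad_iso_add0 L : lad_iso (lad_sum (lad_zero F l) L) L.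
Proof.
by apply: (@lad_isoP (lad_sum (lad_zero F l) L) L _ _
  (is_iso_snd0 _) (is_iso_snd0 _)) => i x; rewrite !morE.
Qed.

End Ladders.

(** * Commutative monoids up to an equivalence, covering direct sums of modules and of ladders *)

Section MonoidUpTo.
Variables (T : Type) (eqv : T -> T -> Prop) (op : T -> T -> T) (z : T).
Hypothesis eqv_refl : forall x, eqv x x.
Hypothesis eqv_sym : forall x y, eqv x y -> eqv y x.
Hypothesis eqv_trans : forall x y w, eqv x y -> eqv y w -> eqv x w.
Hypothesis eqv_op : forall x y x' y',
  eqv x y -> eqv x' y' -> eqv (op x x') (op y y').
Hypothesis eqv_assoc : forall x y w, eqv (op x (op y w)) (op (op x y) w).
Hypothesis eqv_swap : forall x y, eqv (op x y) (op y x).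
Hypothesis eqv_add0 : forall x, eqv (op z x) x.

Lemma eqv_CA x y w : eqv (op x (op y w)) (op y (op x w)).
Proof.
apply: (eqv_trans (eqv_assoc _ _ _)).
apply: (@eqv_trans _ (op (op y x) w)); first exact: eqv_op.
exact/eqv_sym/eqv_assoc.
Qed.

Lemma eqv_big0 (I : finType) (X : I -> T) :
  eqv (\big[op/z]_(i : I) iter 0 (op (X i)) z) z.
Proof.
elim: (index_enum I) => [|i s IH]; first by rewrite big_nil.
rewrite big_cons /=; exact: eqv_trans (eqv_add0 _) IH.
Qed.

(** This records a freshly split summand by raising one multiplicity by one, in a barcode or in the
    decomposition of a ladder. *)
Lemma eqv_big_incr (I : finType) (X : I -> T) (r : I -> nat) (i0 : I) :
  eqv (\big[op/z]_(i : I) iter ((i == i0) + r i) (op (X i)) z)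
      (op (X i0) (\big[op/z]_(i : I) iter (r i) (op (X i)) z)).
Proof.
(* Over an arbitrary list [s], as many copies of [X i0] come to the front as [i0] occurs in [s]; the
   full enumeration contains it exactly once. *)
suff H s : eqv (\big[op/z]_(i <- s) iter ((i == i0) + r i) (op (X i)) z)
    (iter (count_mem i0 s) (op (X i0))
       (\big[op/z]_(i <- s) iter (r i) (op (X i)) z)).
  have := H (index_enum I).
  by rewrite count_uniq_mem ?index_enum_uniq ?mem_index_enum.
have pow_op n x y w : eqv (op x (iter n (op y) w)) (iter n (op y) (op x w)).
  elim: n => [|n IH] //=; apply: (eqv_trans (eqv_CA _ _ _)).
  exact: eqv_op.
elim: s => [|i s IH]; first by rewrite !big_nil.
rewrite !big_cons /=.
have H1 : eqv (op (iter (r i) (op (X i)) z)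
     (\big[op/z]_(i <- s) iter ((i == i0) + r i) (op (X i)) z))
  (iter (count_mem i0 s) (op (X i0)) (op (iter (r i) (op (X i)) z)
     (\big[op/z]_(i <- s) iter (r i) (op (X i)) z))).
  apply: eqv_trans (pow_op _ _ _ _); exact: eqv_op.
case: (eqVneq i i0) H1 => [->|_] H1 //=.
apply: (eqv_trans (eqv_sym (eqv_assoc _ _ _))); exact: eqv_op.
Qed.

End MonoidUpTo.

(** * Split summands and maps of interval modules *)

Definition retract (F : fieldType) (l : nat) (V W : persmod F l)
    (f : pm_mor V W) (g : pm_mor W V) : Prop :=
  forall i x, g i (f i x) = x.

Definition pm_dim (F : fieldType) (l : nat) (V : persmod F l) : nat :=
  (\sum_i \dim {:V i})%N.

Section Splitting.
Variables (F : fieldType) (l : nat) (V E : persmod F l).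
Variables (f : pm_mor E V) (g : pm_mor V E).
Hypothesis fK : retract f g.

Lemma kernel_map_linear (i j : 'I_l.+1) (h : (i <= j)%N) :
  linear (fun u : subvs_of (lker (g i)) =>
            vsproj (lker (g j)) (pm_map V h (vsval u))).
Proof. by move=> a u v; rewrite !linearP. Qed.

Lemma kernel_map_in (i j : 'I_l.+1) (h : (i <= j)%N)
  (u : subvs_of (lker (g i))) : pm_map V h (vsval u) \in lker (g j).
Proof.
have := subvsP u; rewrite !memv_ker mor_naturalE => /eqP->.
by rewrite linear0.
Qed.

(** The complement of [E] in [V], taken as the pointwise kernel of the retraction. The [vsproj] in
    the inner maps only retypes a vector that already lies in the kernel, by [kernel_map_in]. *)
Definition kernel_mod : persmod F l.
Proof.
refine (@PersMod F l (fun i => subvs_of (lker (g i)))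
  (fun i j h => lfun_of (kernel_map_linear h)) _ _) => [i h|i j k hij hjk hik].
  apply/lfunP => u; apply: val_inj; rewrite lfun_ofE id_lfunE /=.
  by rewrite vsprojK ?kernel_map_in // pm_idE.
apply/lfunP => u; apply: val_inj; rewrite comp_lfunE !lfun_ofE /=.
rewrite (vsprojK (kernel_map_in hij u)) (pm_compE _ _ hik).
by [].
Defined.

Lemma vsval_linear (U : vectType F) (S : {vspace U}) :
  linear (fun u : subvs_of S => vsval u).
Proof. by move=> a u v; rewrite linearP. Qed.

Definition kernel_in : pm_mor kernel_mod V.
Proof.
refine (@mk_mor _ _ kernel_mod V
  (fun i => lfun_of (@vsval_linear _ (lker (g i)))) _) => i j h x.
by rewrite !lfun_ofE vsprojK ?kernel_map_in.
Defined.

(** The idempotent 1 - f g is the projection onto the kernel of [g] along the image of [f]. *)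
Lemma kernel_out_linear (i : 'I_l.+1) :
  linear (fun x => vsproj (lker (g i)) (x - f i (g i x))).
Proof.
move=> a x y; rewrite -linearP; congr (vsproj _ _).
by rewrite (linearP (g i)) (linearP (f i)) opprD scalerBr addrACA.
Qed.

Lemma kernel_out_in (i : 'I_l.+1) x : x - f i (g i x) \in lker (g i).
Proof. by rewrite memv_ker linearB /= fK subrr. Qed.

Definition kernel_out : pm_mor V kernel_mod.
Proof.
refine (@mk_mor _ _ V kernel_mod
  (fun i => lfun_of (@kernel_out_linear i)) _) => i j h x.
apply: val_inj; rewrite !lfun_ofE /= !vsprojK ?kernel_out_in //.
  by rewrite linearB /= !mor_naturalE.
by rewrite -(vsprojK (kernel_out_in x)) kernel_map_in.
Defined.

Lemma kernel_inK : retract kernel_in kernel_out.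
Proof.
move=> i x; apply: val_inj; rewrite lfun_ofE /= lfun_ofE.
have := subvsP x; rewrite memv_ker => /eqP->.
by rewrite linear0 subr0 vsprojK ?subvsP.
Qed.

Lemma kernel_outK (i : 'I_l.+1) x :
  kernel_in i (kernel_out i x) = x - f i (g i x).
Proof. by rewrite !lfun_ofE vsprojK ?kernel_out_in. Qed.

Lemma kernel_out_f (i : 'I_l.+1) x : kernel_out i (f i x) = 0.
Proof. by rewrite -[LHS]kernel_inK kernel_outK fK subrr linear0. Qed.

Lemma kernel_in_g (i : 'I_l.+1) x : g i (kernel_in i x) = 0.
Proof.
have /(congr1 (g i)) := kernel_outK (kernel_in i x).
by rewrite kernel_inK linearB /= fK subrr.
Qed.

Lemma kernel_is_iso : is_iso (pair_mor g kernel_out).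
Proof.
(* The inverse sends (e, u) to f e + u; the sum is written as a combination indexed by [bool]. *)
pose h := lincomb_mor (fun=> 1)
  (fun b : bool => if b then comp_mor f (fst_mor E kernel_mod)
                   else comp_mor kernel_in (snd_mor E kernel_mod)).
have hE i x : h i x = f i x.1 + kernel_in i x.2.
  by rewrite lincomb_morE big_bool !scale1r !comp_morE fst_morE snd_morE.
apply: (@is_isoP _ _ _ _ _ h) => i x.
  by rewrite hE pair_morE kernel_outK addrC subrK.
rewrite hE pair_morE !lfunD fK kernel_out_f kernel_in_g kernel_inK.
by rewrite addr0 add0r -surjective_pairing.
Qed.

Lemma kernel_dim_le (i : 'I_l.+1) : (\dim {:kernel_mod i} <= \dim {:V i})%N.
Proof. by rewrite dimvf dimvS ?subvf. Qed.

(** The vector [f i y] lies outside the kernel, since [g] sends it back to [y]; so the kernel is a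
    proper subspace at [i]. *)
Lemma kernel_dim_lt (i : 'I_l.+1) (y : E i) :
  y != 0 -> (pm_dim kernel_mod < pm_dim V)%N.
Proof.
move=> y0; rewrite /pm_dim (bigD1 i) //= [X in (_ < X)%N](bigD1 i) //=.
rewrite -addSn leq_add ?leq_sum // => [|j _]; last exact: kernel_dim_le.
rewrite dimvf ltn_neqAle dimvS ?subvf // andbT.
have [_ ->] := dimv_leqif_eq (subvf (lker (g i))).
apply: contra_neq y0 => eqf.
have : f i y \in lker (g i) by rewrite eqf memvf.
by rewrite memv_ker fK => /eqP.
Qed.

Lemma pm_split :
  exists V' (k : pm_mor V' V) (p : pm_mor V V'),
   [/\ retract k p,
       forall (i : 'I_l.+1) x, k i (p i x) = x - f i (g i x),
       forall (i : 'I_l.+1) y, p i (f i y) = 0,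
       is_iso (pair_mor g p) &
       (pm_dim V' <= pm_dim V)%N /\
       forall (i : 'I_l.+1) (y : E i), y != 0 -> (pm_dim V' < pm_dim V)%N].
Proof.
exists kernel_mod, kernel_in, kernel_out; split.
- exact: kernel_inK.
- exact: kernel_outK.
- exact: kernel_out_f.
- exact: kernel_is_iso.
split; last exact: kernel_dim_lt.
by apply: leq_sum => i _; apply: kernel_dim_le.
Qed.

End Splitting.

(** * Maps between interval modules *)

Section IntervalModules.
Variables (F : fieldType) (l : nat).
Implicit Types (V W X : persmod F l) (J K I : interval l).
Implicit Types (i j : 'I_l.+1).
Local Notation IM := (@interval_module F l).

Lemma regular_homE (f : 'Hom(F^o, F^o)) : exists c : F, f = c *: \1%VF.
Proof.
exists (f 1); apply/lfunP => x; rewrite scale_lfunE id_lfunE.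
have {1}-> : x = x *: (1 : F^o) by rewrite /GRing.scale /= mulr1.
by rewrite linearZ; exact: mulrC.
Qed.

Lemma fib_homE b1 b2 (f : 'Hom(fib F b1, fib F b2)) :
  exists c, f = c *: fib_map F b1 b2.
Proof.
case: b1 b2 f => [] [] f /=; last 3 first.
- by exists 0; apply/lfunP => x; rewrite scale0r zero_lfunE [LHS]thinmx0.
- by exists 0; apply/lfunP => x; rewrite scale0r [x]thinmx0 !linear0.
- by exists 0; apply/lfunP => x; rewrite scale0r [x]thinmx0 !linear0.
exact: regular_homE.
Qed.

Lemma fib_map_eq0 b1 b2 : (fib_map F b1 b2 == 0) = ~~ (b1 && b2).
Proof.
case: b1 b2 => [] [] /=; rewrite ?eqxx //; apply/negbTE/eqP.
move=> /lfunP/(_ 1); rewrite id_lfunE zero_lfunE => /eqP.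
by rewrite oner_eq0.
Qed.

Lemma fib_map_compE b1 b2 b3 :
  (fib_map F b2 b3 \o fib_map F b1 b2)%VF = b2%:R *: fib_map F b1 b3.
Proof.
by case: b1 b2 b3 => [] [] [] /=;
  rewrite ?comp_lfun0r ?comp_lfun0l ?comp_lfun1l ?scaler0 ?scale1r ?scale0r.
Qed.

Lemma fib_map_idE b x : fib_map F b b x = x.
Proof. by rewrite fib_map_id id_lfunE. Qed.

Lemma in_lo J : in_interval J (lo J).
Proof. by rewrite /in_interval leqnn; have := valP J. Qed.

Lemma in_hi J : in_interval J (hi J).
Proof. by rewrite /in_interval leqnn andbT; have := valP J. Qed.

(* At the pairs (i, i + n), th is a morphism from k_J to the shift of k_K by n;
   its values at the other pairs are irrelevant. *)
Lemma shifted_interval_mor n J K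
    (th : forall i i', 'Hom(IM J i, IM K i')) :
  (forall i i' j j' (h : (i <= j)%N) (h' : (i' <= j')%N),
     i' = (i + n)%N :> nat -> j' = (j + n)%N :> nat ->
     (th j j' \o pm_map (IM J) h)%VF = (pm_map (IM K) h' \o th i i')%VF) ->
  forall i i', i' = (i + n)%N :> nat -> th i i' != 0 ->
  [/\ in_interval J i, in_interval K i',
      (lo K <= lo J + n)%N & (hi K <= hi J + n)%N].
Proof.
move=> thN i i' ei nz.
have th0 j j' : ~~ (in_interval J j && in_interval K j') -> th j j' = 0.
  rewrite -fib_map_eq0 => /eqP z; have [c ->] := fib_homE (th j j').
  by rewrite z scaler0.
have /andP[Ji Ki] : in_interval J i && in_interval K i'.
  by apply: contraNT nz => /th0->.
have [c thc] := fib_homE (th i i').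
have c0 : c != 0 by apply: contraNneq nz => cz; rewrite thc cz scale0r.
have [Ji1 Ji2] := andP Ji; have [Ki1 Ki2] := andP Ki.
split=> //; rewrite leqNgt; apply/negP => lt.
(* If lo J + n < lo K, then [th] vanishes at (lo J, lo J + n). Naturality from there to (i, i')
   would make [th i i'] zero, because k_J is the identity from lo J to i. *)
- have ltl : (lo J + n < l.+1)%N.
    by apply: ltn_trans lt _; apply: ltn_ord.
  have lei : (Ordinal ltl <= i')%N by rewrite /= ei leq_add2r.
  have := thN _ (Ordinal ltl) _ _ Ji1 lei erefl ei.
  rewrite (th0 (lo J)); last first.
    by rewrite /in_interval /= (leqNgt (lo K)) lt andbF.
  rewrite comp_lfun0r thc -comp_lfunZl /= fib_map_compE Ji scale1r.
  by move/eqP; rewrite scaler_eq0 (negbTE c0) fib_map_eq0 in_lo Ki.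
(* Dually, if hi J + n < hi K, then [th] vanishes at (hi K - n, hi K), which naturality compares
   with (i, i'). The subtraction is exact, as n <= i' <= hi K. *)
- have ltl : (hi K - n < l.+1)%N.
    by apply: leq_ltn_trans (leq_subr _ _) _; apply: ltn_ord.
  have lei : (i <= Ordinal ltl)%N by move: Ki2; rewrite ei /=; lia.
  have eh : hi K = (Ordinal ltl + n)%N :> nat by move: Ki2; rewrite ei /=; lia.
  have := thN _ _ _ _ lei Ki2 ei eh.
  rewrite (th0 (Ordinal ltl)); last first.
    by rewrite /in_interval /=; lia.
  rewrite comp_lfun0l thc -comp_lfunZr /= fib_map_compE Ki scale1r.
  by move/esym/eqP; rewrite scaler_eq0 (negbTE c0) fib_map_eq0 in_hi Ji.
Qed.

(** The inner map without a proof of [i <= j] as argument; its value is 0 when [j < i]. *)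
Definition total_map V i j : 'Hom(V i, V j) :=
  if @idP (i <= j)%N is ReflectT h then pm_map V h else 0.

Lemma total_mapE V i j (h : (i <= j)%N) : total_map V i j = pm_map V h.
Proof.
rewrite /total_map; case: {-}_ / idP => [h'|//]; exact: pm_map_irr.
Qed.

(** The case n = 0 of [shifted_interval_mor] compares the endpoints, and the index [i], common to
    both intervals, gives lo J <= hi K. *)
Lemma interval_mor_preceq J K (f : pm_mor (IM J) (IM K)) i :
  f i != 0 -> preceq K J.
Proof.
move=> nz; pose th i i' := (total_map (IM K) i i' \o f i)%VF.
have [||Ji Ki l1 l2] :=
    @shifted_interval_mor 0 J K th _ i i (esym (addn0 _)) _; last first.
- move: Ji Ki l1 l2; rewrite !addn0 /in_interval /preceq.
  move=> /andP[a _] /andP[_ b] -> ->; rewrite andbT /=.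
  exact: leq_trans a b.
- by rewrite /th (total_mapE _ (leqnn i)) pm_id comp_lfun1l.
move=> j j' k k' h h'; rewrite !addn0 => /val_inj ej /val_inj ek.
subst j' k'; rewrite /th !(total_mapE _ (leqnn _)) !pm_id !comp_lfun1l.
by rewrite mor_natural (pm_map_irr _ h h').
Qed.

(** Two indices common to J and K are linked by identities of F in both modules, so naturality
    forces the same scalar at both. A zero morphism gets c = 0, which makes the implication
    vacuous. *)
Lemma interval_mor_scalar J K (f : pm_mor (IM J) (IM K)) :
  exists c, (c != 0 -> preceq K J) /\
    forall i x, f i x = c *: fib_map F (in_interval J i) (in_interval K i) x.
Proof.
case: (pselect (exists i, f i != 0)) => [[i nz]|z]; last first.
  exists 0; rewrite eqxx; split=> // i x; rewrite scale0r.
  case: (eqVneq (f i) 0) => [->|nz]; first exact: zero_lfunE.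
  by case: z; exists i.
have [c fc] := fib_homE (f i).
exists c; split=> [_|j x]; first exact: interval_mor_preceq nz.
have [d fd] := fib_homE (f j).
have /andP[Ji Ki] : in_interval J i && in_interval K i.
  by apply: contraNT nz; rewrite -fib_map_eq0 fc => /eqP->; rewrite scaler0.
have [/andP[Jj Kj]|] := boolP (in_interval J j && in_interval K j); last first.
  by rewrite fd -fib_map_eq0 => /eqP->; rewrite scaler0 !zero_lfunE scaler0.
suff -> : c = d by rewrite fd scale_lfunE.
have aux (a b : bool) (s t : F) : a -> b ->
    s *: fib_map F a b = t *: fib_map F a b -> s = t.
  move=> Ha Hb /eqP; rewrite -subr_eq0 -scalerBl scaler_eq0 fib_map_eq0 Ha Hb.
  by rewrite orbF subr_eq0 => /eqP.
case/orP: (leq_total i j) => h.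
  have := mor_natural f h; rewrite fc fd -comp_lfunZl -comp_lfunZr /=.
  by rewrite !fib_map_compE Jj Ki !scale1r => /aux->.
have := mor_natural f h; rewrite fc fd -comp_lfunZl -comp_lfunZr /=.
by rewrite !fib_map_compE Ji Kj !scale1r => /aux->.
Qed.

End IntervalModules.

(** * Barcodes *)

Section Barcodes.
Variables (F : fieldType) (l : nat).
Implicit Types (V W X : persmod F l) (J K I : interval l).
Implicit Types (i j : 'I_l.+1).
Local Notation IM := (@interval_module F l).

Definition scale_mor V W (c : F) (f : pm_mor V W) : pm_mor V W :=
  lincomb_mor (fun _ : 'I_1 => c) (fun=> f).

Lemma scale_morE V W c (f : pm_mor V W) i x : scale_mor c f i x = c *: f i x.
Proof. by rewrite lincomb_morE big_ord1. Qed.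

Definition summand J V : Prop :=
  exists (f : pm_mor (IM J) V) (g : pm_mor V (IM J)), retract f g.

Lemma exists_gen J : exists x : IM J (lo J), x != 0.
Proof. by rewrite /= in_lo; exists 1; apply: oner_neq0. Qed.

Lemma summand_retract J V W (f : pm_mor V W) (g : pm_mor W V) :
  retract f g -> summand J V -> summand J W.
Proof.
move=> fK [h [k hK]]; exists (comp_mor f h), (comp_mor k g) => i x.
by rewrite !morE fK hK.
Qed.

(** The Krull-Schmidt exchange argument: endomorphisms of k_J are scalars, and the identity is the
    sum of the scalars [c1] and [c2] obtained through the two factors. One of them is nonzero, and
    dividing by it gives a retraction. *)
Lemma summand_sum J V W :
  summand J (pm_sum V W) -> summand J V \/ summand J W.
Proof.
case=> f [g fK].
pose f1 := comp_mor (fst_mor V W) f; pose g1 := comp_mor g (inl_mor V W).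
pose f2 := comp_mor (snd_mor V W) f; pose g2 := comp_mor g (inr_mor V W).
have [c1 [_ H1]] := interval_mor_scalar (comp_mor g1 f1).
have [c2 [_ H2]] := interval_mor_scalar (comp_mor g2 f2).
have E i (x : IM J i) : (c1 + c2) *: x = x.
  have := H2 i x; have := H1 i x; rewrite fib_map_idE scalerDl => <- <-.
  rewrite !morE -linearD -[RHS]fK; congr (g i _).
  by case: (f i x) => y z; apply/pair_equal_spec; rewrite /= addr0 add0r.
have conclude V' (h : pm_mor (IM J) V') (k : pm_mor V' (IM J)) c :
    c != 0 -> (forall i x, comp_mor k h i x = c *: fib_map F _ _ x) ->
    summand J V'.
  move=> c0 H; exists h, (scale_mor c^-1 k) => i x.
  by rewrite scale_morE -comp_morE H fib_map_idE scalerA mulVf // scale1r.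
have [c1z|c1nz] := eqVneq c1 0; last by left; apply: conclude H1.
have [c2z|c2nz] := eqVneq c2 0; last by right; apply: conclude H2.
have [x /eqP[]] := exists_gen J.
by rewrite -[LHS]E c1z c2z addr0 scale0r.
Qed.

Lemma summand_neq0 J V : summand J V -> exists i (x : V i), x != 0.
Proof.
case=> f [g fK]; have [x x0] := exists_gen J.
exists (lo J), (f _ x); apply: contraNneq x0 => fx.
by rewrite -(fK _ x) fx linear0.
Qed.

Lemma preceq_anti J K : preceq J K -> preceq K J -> J = K.
Proof.
move=> /and3P[a _ b] /and3P[c _ d]; apply/val_inj.
rewrite [val J]surjective_pairing [val K]surjective_pairing.
by congr (_, _); apply/val_inj/eqP; rewrite eqn_leq; apply/andP; split.
Qed.

(** Both maps of the retract are nonzero at [lo J], so [preceq] holds in both directions. *)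
Lemma summand_interval J K : summand J (IM K) -> J = K.
Proof.
case=> f [g fK]; have [x x0] := exists_gen J.
have nz : f (lo J) x != 0.
  by apply: contraNneq x0 => fx; rewrite -(fK _ x) fx linear0.
apply: preceq_anti.
  apply: (@interval_mor_preceq F l K J g (lo J)).
  by apply: contraNneq x0 => g0; rewrite -(fK _ x) g0 zero_lfunE.
apply: (@interval_mor_preceq F l J K f (lo J)).
by apply: contraNneq nz => f0; rewrite f0 zero_lfunE.
Qed.

Lemma summand_zero J : ~ summand J (pm_zero F l).
Proof. by move=> /summand_neq0[i [x /eqP[]]]; apply: pm_zero_eq0. Qed.

(** Repeated use of [summand_sum] pushes the summand into a single interval module k_I of positive
    multiplicity, and then J = I. *)
Lemma summand_barcode V (B : {mset interval l}%mset) J :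
  is_barcode V B -> summand J V -> J \in B.
Proof.
case=> f /is_isoE[g [fK _]] /(summand_retract fK).
elim: (index_enum _) => [|I s IH]; first by rewrite big_nil => /summand_zero.
rewrite big_cons => /summand_sum[{IH}|//].
rewrite in_mset /pm_pow; case BI: (B I) => [|n].
  by move/summand_zero.
suff : summand J (pm_pow (IM I) n.+1) -> J = I.
  by move=> H /H->; rewrite BI.
elim: n {BI} => [|n IH] /summand_sum[/summand_interval|] //.
by move/summand_zero.
Qed.

Lemma scale_linear (U : vectType F) (y : U) : linear (fun c : F^o => c *: y).
Proof. by move=> a u v; rewrite scalerDl scalerA. Qed.

(** A vector as a map out of a fibre; [fib_out] is the dual, a functional as a map into one. For [b]
    false both are the zero map. *)
Definition fib_in b (U : vectType F) (y : U) : 'Hom(fib F b, U) :=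
  if b as b0 return 'Hom(fib F b0, U) then lfun_of (scale_linear y) else 0.

Definition fib_out b (U : vectType F) (f : 'Hom(U, F^o)) : 'Hom(U, fib F b) :=
  if b as b0 return 'Hom(U, fib F b0) then f else 0.

(** For a map out of an interval module, naturality only constrains indices inside the interval: the
    vector is carried along there and must die on leaving. For [fib_out_natural] the constraint sits
    at the entrance instead. *)
Lemma fib_in_natural (b1 b2 : bool) (U U' : vectType F) (f : 'Hom(U, U'))
    y y' x :
  (b1 -> f y = if b2 then y' else 0) ->
  fib_in b2 y' (fib_map F b1 b2 x) = f (fib_in b1 y x).
Proof.
case: b1 b2 x => [] [] x /= H; rewrite ?zero_lfunE ?linear0 ?id_lfunE //.
  by rewrite !lfun_ofE linearZ /= H.
by rewrite lfun_ofE linearZ /= H // scaler0.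
Qed.

Lemma fib_out_natural (b1 b2 : bool) (U U' : vectType F) (f : 'Hom(U, U'))
    (phi : 'Hom(U, F^o)) (phi' : 'Hom(U', F^o)) u :
  (b2 -> phi' (f u) = if b1 then phi u else 0) ->
  fib_out b2 phi' (f u) = fib_map F b1 b2 (fib_out b1 phi u).
Proof.
by case: b1 b2 => [] [] /= H; rewrite ?zero_lfunE ?linear0 ?id_lfunE ?H.
Qed.

Lemma fib_outK (b : bool) (U : vectType F) (phi : 'Hom(U, F^o)) y x :
  (b -> phi y = 1) -> fib_out b phi (fib_in b y x) = x.
Proof.
case: b x => [] x /= H; last by rewrite [x]thinmx0 zero_lfunE.
by rewrite lfun_ofE linearZ /= H //; apply: mulr1.
Qed.

(* Among the nonzero vectors of the first nonzero space V_i, one that survives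
   longest, say up to j, generates a copy of k_[i,j]; a functional on V_j that
   does not kill it gives the retraction. *)
Lemma exists_summand V i (x : V i) : x != 0 -> exists J, summand J V.
Proof.
move=> x0.
pose P i := (0 < \dim {:V i})%N.
have Pi : P i.
  rewrite /P lt0n dimv_eq0; apply: contraNneq x0 => V0.
  by have := memvf x; rewrite V0 memv0.
case: (arg_minnP (fun i : 'I_l.+1 => i : nat) Pi) => {Pi x x0}i Pi mini.
pose Q j := total_map V i j != 0.
have Qi : Q i.
  rewrite /Q (total_mapE _ (leqnn i)) pm_id; apply: contraTneq Pi => /lfunP id0.
  rewrite /P -leqNgt leqn0 dimv_eq0 -subv0; apply/subvP => y _.
  by rewrite memv0 -(id_lfunE y) id0 zero_lfunE.
case: (arg_maxnP (fun j : 'I_l.+1 => j : nat) Qi) => {Qi}j Qj maxj.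
have hij : (i <= j)%N.
  by move: Qj; rewrite /Q /total_map; case: {-}_ / idP => // _; rewrite eqxx.
have [x xj] := lfun_neq0P Qj.
rewrite (total_mapE _ hij) in xj.
have [phi phix] := exists_dual xj.
pose J : interval l := exist _ (i, j) hij.
(* Minimality of [i] makes the retraction natural at the left end of J; maximality of [j], through
   [T0], makes the inclusion natural at the right end. *)
have V0 k (z : V k) : (k < i)%N -> z = 0.
  rewrite ltnNge => lt; apply/eqP; apply: contraNT lt => z0.
  apply: mini; rewrite /P lt0n dimv_eq0; apply: contraNneq z0 => Vk0.
  by have := memvf z; rewrite Vk0 memv0.
have T0 (k : 'I_l.+1) : (j < k)%N -> total_map V i k = 0.
  rewrite ltnNge => lt; apply/eqP; apply: contraNT lt; exact: maxj.
have TE (k k' : 'I_l.+1) (h : (k <= k')%N) (hik : (i <= k)%N) :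
    pm_map V h (total_map V i k x) = total_map V i k' x.
  rewrite (total_mapE _ hik) (total_mapE _ (leq_trans hik h)).
  exact: pm_compE.
have TE' (k k' : 'I_l.+1) (h : (k <= k')%N) (hkj : (k' <= j)%N) z :
    total_map V k' j (pm_map V h z) = total_map V k j z.
  rewrite (total_mapE _ hkj) (total_mapE _ (leq_trans h hkj)).
  exact: pm_compE.
have fN (k k' : 'I_l.+1) (h : (k <= k')%N) y :
    fib_in (in_interval J k') (total_map V i k' x) (pm_map (IM J) h y) =
    pm_map V h (fib_in (in_interval J k) (total_map V i k x) y).
  apply: fib_in_natural => /andP[hik _]; rewrite TE // /in_interval.
  rewrite (leq_trans hik h) /=; case: leqP => // /T0->.
  by rewrite zero_lfunE.
have gN (k k' : 'I_l.+1) (h : (k <= k')%N) y :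
   fib_out (in_interval J k') (phi \o total_map V k' j)%VF (pm_map V h y) =
   pm_map (IM J) h (fib_out (in_interval J k) (phi \o total_map V k j)%VF y).
  apply: fib_out_natural => /andP[_ hkj]; rewrite !comp_lfunE TE' //.
  rewrite /in_interval (leq_trans h hkj) andbT; case: leqP => // lt.
  by rewrite (V0 _ y lt) !linear0.
exists J, (@mk_mor F l (IM J) V
    (fun k => fib_in (in_interval J k) (total_map V i k x)) fN),
  (@mk_mor F l V (IM J)
    (fun k => fib_out (in_interval J k) (phi \o total_map V k j)%VF) gN).
move=> k y; apply: fib_outK => /andP[hik hkj].
rewrite comp_lfunE (total_mapE _ hik) (total_mapE _ hkj).
by rewrite (pm_compE _ _ hij).
Qed.

(** Induction on the total dimension: [exists_summand] and [pm_split] split one interval module off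
    any nonzero module. *)
Lemma persmod_ind (P : persmod F l -> Prop) :
  (forall V W, pm_iso V W -> P W -> P V) -> P (pm_zero F l) ->
  (forall J V, P V -> P (pm_sum (IM J) V)) -> forall V, P V.
Proof.
move=> Piso P0 Psum V; have [n] := ubnP (pm_dim V).
elim: n V => // n IH V; rewrite ltnS => Vn.
case: (pselect (exists i (x : V i), x != 0)) => [[i [x x0]]|V0]; last first.
  apply: (Piso _ _ _ P0); exists (zero_mor _ _); apply: is_iso_to0 => i x.
  by apply/eqP/negPn/negP => x0; apply: V0; exists i, x.
have [J [f [g fK]]] := exists_summand x0.
have [V' [k [p [_ _ _ isoV' [_ dlt]]]]] := pm_split fK.
apply: (Piso _ (pm_sum (IM J) V')); first by exists (pair_mor g p).
apply/Psum/IH; apply: leq_trans Vn.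
by have [y y0] := exists_gen J; apply: dlt y0.
Qed.

Lemma exists_barcode V : exists B, is_barcode V B.
Proof.
elim/persmod_ind: V => [V W VW [B WB]||J V [B VB]].
- by exists B; apply: pm_iso_trans VW WB.
- exists mset0; apply: pm_iso_sym.
  rewrite (eq_bigr (fun J => iter 0 (pm_sum (IM J)) (pm_zero F l))).
    exact: (eqv_big0 (@pm_iso_refl F l) (@pm_iso_trans F l)
                     (@pm_iso_add0 F l)).
  by move=> J _; rewrite mset0E.
exists (J +` B)%mset; apply: pm_iso_trans (pm_iso_sum (pm_iso_refl _) VB) _.
apply: pm_iso_sym.
rewrite (eq_bigr (fun I => iter ((I == J) + B I)%N (pm_sum (IM I))
                            (pm_zero F l))).
  exact: (eqv_big_incr (pm_zero F l) (@pm_iso_refl F l) (@pm_iso_sym F l)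
    (@pm_iso_trans F l) (@pm_iso_sum F l) (@pm_iso_assoc F l)
    (@pm_iso_swap F l)).
by move=> I _; rewrite mset1DE.
Qed.

(** As a barcode exists, [xget] returns one, and [summand_barcode] applies to any barcode. *)
Lemma summand_Bar V J : summand J V -> J \in Bar V.
Proof.
apply: summand_barcode; have [B VB] := exists_barcode V.
exact: (xgetPex mset0 (ex_intro _ B VB)).
Qed.

(** An interval decomposition as biproduct data, so that a morphism has matrix entries [bb_out]
    after it after [bb_in]. Equal bars appear under distinct indices. *)
Record bar_basis V := BarBasis {
  bb_index : finType;
  bb_bar : bb_index -> interval l;
  bb_in : forall a, pm_mor (IM (bb_bar a)) V;
  bb_out : forall a, pm_mor V (IM (bb_bar a));
  bb_inK : forall a, retract (bb_in a) (bb_out a);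
  bb_ortho : forall a b i x, a != b -> bb_out a i (bb_in b i x) = 0;
  bb_sum : forall i x, \sum_a bb_in a i (bb_out a i x) = x
}.

Lemma exists_bar_basis V : inhabited (bar_basis V).
Proof.
elim/persmod_ind: V => [V W [f /is_isoE[g [fK gK]]]||].
  case=> -[A J fi fo fiK fiO fiS].
  constructor; exists A J (fun a => comp_mor g (fi a))
    (fun a => comp_mor (fo a) f) => [a i x|a b i x ab|i x].
  - by rewrite !morE gK fiK.
  - by rewrite !morE gK fiO.
  - under eq_bigr do rewrite !morE.
    by rewrite -linear_sum /= fiS fK.
- constructor.
  exists void (fun a : void => match a with end)
    (fun a : void => match a with end)
    (fun a : void => match a with end) => [[]|[]|i x].
  by rewrite [RHS]pm_zero_eq0 big1 // => -[].
move=> J V [[A K fi fo fiK fiO fiS]]; constructor.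
pose K' (a : unit + A) := if a is inr a then K a else J.
pose fi' (a : unit + A) : pm_mor (IM (K' a)) (pm_sum (IM J) V) :=
  match a with inr a => comp_mor (inr_mor _ _) (fi a) | _ => inl_mor _ _ end.
pose fo' (a : unit + A) : pm_mor (pm_sum (IM J) V) (IM (K' a)) :=
  match a with inr a => comp_mor (fo a) (snd_mor _ _) | _ => fst_mor _ _ end.
exists (unit + A)%type K' fi' fo'.
- by case=> [?|a] i x; rewrite !morE // fiK.
- case=> [[]|a] [[]|b] i x ab; rewrite /fo' /fi' ?morE ?linear0 //.
  by rewrite fiO //; apply: contraNneq ab => ->.
move=> i [x y]; rewrite big_sumType (big_pred1 tt); last by case.
transitivity (inl_mor (IM J) V i (fst_mor (IM J) V i (x, y)) +
    \sum_a comp_mor (inr_mor (IM J) V) (fi a) i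
              (comp_mor (fo a) (snd_mor (IM J) V) i (x, y))) => //.
rewrite fst_morE inl_morE.
under eq_bigr do rewrite !comp_morE snd_morE.
rewrite -linear_sum fiS [X in _ + X](inr_morE (IM J) y).
by apply/pair_equal_spec; rewrite /= addr0 add0r.
Qed.

End Barcodes.

(** * Shift inverses *)

Section ShiftInverses.
Variables (F : fieldType) (l n : nat).
Implicit Types (V W : persmod F l) (L E : ladder F l) (i j : 'I_l.+1).

(* The components W_i -> V_{i+n} of a morphism W -> V(n), as a family that is
   meaningful at the pairs (i, i + n) of indices only. *)
Definition shift_natural V W (psi : forall i i', 'Hom(W i, V i')) : Prop :=
  forall i i' j j' (h : (i <= j)%N) (h' : (i' <= j')%N),
    i' = (i + n)%N :> nat -> j' = (j + n)%N :> nat ->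
    forall y, psi j j' (pm_map W h y) = pm_map V h' (psi i i' y).

Definition shift_inverse V W (f : pm_mor V W)
    (psi : forall i i', 'Hom(W i, V i')) : Prop :=
  forall i i' (h : (i <= i')%N), i' = (i + n)%N :> nat ->
    (forall x, psi i i' (f i x) = pm_map V h x) /\
    (forall y, f i' (psi i i' y) = pm_map W h y).

(** The bound n < Xi(V) expressed through retracts instead of [Bar], a form that passes at once to
    complements. *)
Definition gapped V : Prop :=
  forall J K, summand J V -> summand K V -> nested J K ->
    (lo K + n < lo J)%N /\ (hi J + n < hi K)%N.

Definition good L : Prop :=
  [/\ exists2 psi, shift_natural psi & shift_inverse (lad_mor L) psi,
      gapped (lad_dom L) & gapped (lad_cod L)].

Lemma gapped_retract V W (f : pm_mor V W) (g : pm_mor W V) :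
  retract f g -> gapped W -> gapped V.
Proof.
by move=> fK gW J K sJ sK; apply: gW; apply: summand_retract fK _.
Qed.

(** Identifies the extended object at [Some i] with [V i]. Going through [total_map], which is the
    identity at equal indices, avoids a transport along an equality of indices. *)
Definition ext_proj V (o : option 'I_l.+1) i : 'Hom(ext_obj V o, V i) :=
  match o return 'Hom(ext_obj V o, V i) with
  | Some j => total_map V j i
  | None => 0
  end.

Lemma ext_proj_map V (o1 o2 : option 'I_l.+1) i j (h : ext_le o1 o2)
    (h' : (i <= j)%N) x :
  o1 = Some i -> o2 = Some j ->
  ext_proj V o2 j (ext_map V h x) = pm_map V h' (ext_proj V o1 i x).
Proof.
move=> e1 e2; subst o1 o2; rewrite /= !(total_mapE _ (leqnn _)) !pm_idE.
by rewrite (pm_map_irr _ h h').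
Qed.

Lemma ext_proj_mor V W (f : pm_mor V W) (o : option 'I_l.+1) i x :
  o = Some i -> f i (ext_proj V o i x) = ext_proj W o i (ext_mor f o x).
Proof. by move=> e; subst o; rewrite /= !(total_mapE _ (leqnn _)) !pm_idE. Qed.

Lemma delta_invertible_shift V W (f : pm_mor V W) (delta : rat) :
  n%:R = 2 * delta -> delta_invertible delta f ->
  exists2 psi, shift_natural psi & shift_inverse f psi.
Proof.
move=> nE [m mE [Psi PsiP]].
have {mE} emn : m = n.
  by apply/eqP; rewrite -(eqr_nat rat) mE nE.
subst m.
have someE i i' : i' = (i + n)%N :> nat -> insub (i + n)%N = Some i'.
  by move=> <-; rewrite valK.
exists (fun i i' => ext_proj V (insub (i + n)%N) i' \o Psi i)%VF.
  move=> i i' j j' h h' ei ej y.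
  rewrite !comp_lfunE (mor_naturalE Psi h y).
  exact: ext_proj_map (someE _ _ ei) (someE _ _ ej).
move=> i i' h ei; have [H1 H2] := PsiP i; split=> z.
  have /lfunP/(_ z) := H1; rewrite !comp_lfunE => ->.
  rewrite (@ext_proj_map V (Some i) _ i i' (ext_le_trans n i) h z
    erefl (someE _ _ ei)) /=.
  by rewrite (total_mapE _ (leqnn i)) pm_idE.
have /lfunP/(_ z) := H2; rewrite !comp_lfunE => H.
rewrite (ext_proj_mor _ _ (someE _ _ ei)).
rewrite -[ext_mor _ _ _]/(shift_mor n f i _) H.
rewrite (@ext_proj_map W (Some i) _ i i' (ext_le_trans n i) h z
    erefl (someE _ _ ei)) /=.
by rewrite (total_mapE _ (leqnn i)) pm_idE.
Qed.

Definition lad_dim L := (pm_dim (lad_dom L) + pm_dim (lad_cod L))%N.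

(** Both the images and the kernels of the retract are respected by the ladder map, so it splits.
    The inverse up to shift may mix the two parts, yet its compression [pv] after [psi] after [kw]
    is again an inverse up to shift on the complement. *)
Lemma lad_split L E (fv : pm_mor (lad_dom E) (lad_dom L))
    (gv : pm_mor (lad_dom L) (lad_dom E)) (fw : pm_mor (lad_cod E) (lad_cod L))
    (gw : pm_mor (lad_cod L) (lad_cod E)) :
  retract fv gv -> retract fw gw ->
  (forall i x, lad_mor L i (fv i x) = fw i (lad_mor E i x)) ->
  (forall i x, lad_mor E i (gv i x) = gw i (lad_mor L i x)) ->
  (exists i (x : lad_dom E i), x != 0) \/
    (exists i (x : lad_cod E i), x != 0) ->
  good L ->
  exists L', [/\ lad_iso L (lad_sum E L'), good L' &
    (lad_dim L' < lad_dim L)%N].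
Proof.
move=> fvK fwK fvw gvw nz [[psi psiN psiP] gapV gapW].
have [V' [kv [pv [kvK pvK pvf isoV [leV ltV]]]]] := pm_split fvK.
have [W' [kw [pw [kwK pwK pwf isoW [leW ltW]]]]] := pm_split fwK.
pose f' := comp_mor pw (comp_mor (lad_mor L) kv).
have f'E i x : f' i x = pw i (lad_mor L i (kv i x)) by rewrite !comp_morE.
(* Dropping the E-part of [x] changes the image only by an element of the image of [fw], which [pw]
   kills. *)
have pwL i x : pw i (lad_mor L i (kv i (pv i x))) = pw i (lad_mor L i x).
  by rewrite pvK !lfunB fvw pwf subr0.
exists (Ladder f'); split.
- apply: (@lad_isoP _ _ L (lad_sum E (Ladder f')) _ _ isoV isoW) => i x.
  by rewrite [LHS]sum_morE !pair_morE f'E pwL gvw.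
- split; [|exact: gapped_retract kvK gapV|exact: gapped_retract kwK gapW].
  have f'E' i x : lad_mor (Ladder f') i x =
    pw i (lad_mor L i (kv i x)) by exact: f'E.
  exists (fun i i' => pv i' \o psi i i' \o kw i)%VF.
    move=> i i' j j' h h' ei ej y; rewrite !comp_lfunE mor_naturalE.
    by rewrite (psiN _ _ _ _ h h' ei ej) mor_naturalE.
  move=> i i' h ei; have [H1 H2] := psiP i i' h ei; split=> z.
    rewrite !comp_lfunE ?f'E' pwK -gvw.
    (* Hence the ladder map sends the complement of V into that of W, and projecting by [pw] loses
       nothing before [psi] is applied. *)
    have gk : gv i (kv i z) = 0.
      have /(congr1 (gv i)) := pvK i (kv i z).
      by rewrite kvK lfunB fvK subrr.
    by rewrite gk !lfun0 subr0 H1 mor_naturalE kvK.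
  by rewrite !comp_lfunE ?f'E' pwL H2 mor_naturalE kwK.
- case: nz => -[i [x x0]].
    by rewrite -addSn leq_add // (ltV i x).
  by rewrite -addnS leq_add // (ltW i x).
Qed.

End ShiftInverses.

(** * The pivot *)

Section Pivot.
Variables (F : fieldType) (l n : nat).
Implicit Types (V W : persmod F l) (J K : interval l) (i j : 'I_l.+1).
Local Notation IM := (@interval_module F l).

(** A total version of [rho], fit for linear combinations over a whole row or column; the
    coefficient is 0 where [preceq] may fail. *)
Definition rho_or_0 K J : pm_mor (IM J) (IM K) :=
  if @idP (preceq K J) is ReflectT h then rho F h else zero_mor _ _.

Lemma rho_or_0E K J i x : preceq K J ->
  rho_or_0 K J i x = fib_map F (in_interval J i) (in_interval K i) x.
Proof. by rewrite /rho_or_0; case: {-}_ / idP. Qed.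

Lemma preceq_refl J : preceq J J.
Proof. by rewrite /preceq !leqnn andbT /=; have := valP J. Qed.

(** An index common to I and K lies in J, since lo J <= lo K <= i <= hi I <= hi J; so passing
    through k_J loses nothing. *)
Lemma rho_trans I J K i x : preceq I J -> preceq J K ->
  fib_map F (in_interval J i) (in_interval I i)
    (fib_map F (in_interval K i) (in_interval J i) x) =
  fib_map F (in_interval K i) (in_interval I i) x.
Proof.
move=> /and3P[_ _ h1] /and3P[h2 _ _].
rewrite -comp_lfunE fib_map_comp // => /andP[a _] /andP[_ b].
by rewrite /in_interval (leq_trans h2 a) (leq_trans b h1).
Qed.

Lemma fib_map_neq0 (b1 b2 : bool) (x : fib F b1) :
  b1 -> b2 -> x != 0 -> fib_map F b1 b2 x != 0.
Proof. by case: b1 b2 x => [] [] //= x _ _; rewrite id_lfunE. Qed.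

Lemma interval_map_neq0 J i j (h : (i <= j)%N) x :
  in_interval J i -> in_interval J j -> x != 0 -> pm_map (IM J) h x != 0.
Proof. exact: fib_map_neq0. Qed.

Lemma shifted_entry V W J K (psi : forall i i', 'Hom(W i, V i'))
    (f : pm_mor (IM J) W) (g : pm_mor V (IM K)) i i' x :
  shift_natural n psi -> i' = (i + n)%N :> nat ->
  g i' (psi i i' (f i x)) != 0 ->
  (lo K <= lo J + n)%N /\ (hi K <= hi J + n)%N.
Proof.
move=> psiN ei nz; pose th i i' := (g i' \o psi i i' \o f i)%VF.
have [||_ _ ? ?] // := @shifted_interval_mor F l n J K th _ i i' ei.
  move=> j j' k k' h h' ej ek; apply/lfunP => y; rewrite !comp_lfunE.
  by rewrite mor_naturalE (psiN _ _ _ _ h h' ej ek) mor_naturalE.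
apply: contraNneq nz => th0.
by rewrite -2!comp_lfunE -/(th i i') th0 zero_lfunE.
Qed.

(** Base-N digits turn the lexicographic order on pairs into the order of numbers, as used by
    [arg_maxnP] and [arg_minnP] for the pivot. *)
Lemma lex_le N a b c d : (b < N)%N -> (d < N)%N ->
  (a * N + b <= c * N + d)%N -> (a < c)%N \/ a = c /\ (b <= d)%N.
Proof. nia. Qed.

Variables (V W : persmod F l) (Phi : pm_mor V W).
Hypothesis goodPhi : good n (Ladder Phi).
Variables (bV : bar_basis V) (bW : bar_basis W).
Local Notation J := (@bb_bar _ _ _ bV).
Local Notation K := (@bb_bar _ _ _ bW).
Local Notation iV := (@bb_in _ _ _ bV).
Local Notation pV := (@bb_out _ _ _ bV).
Local Notation iW := (@bb_in _ _ _ bW).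
Local Notation pW := (@bb_out _ _ _ bW).
Variable c : bb_index bW -> bb_index bV -> F.
Hypothesis c_preceq : forall a b, c a b != 0 -> preceq (K a) (J b).
Hypothesis cE : forall a b i x, pW a i (Phi i (iV b i x)) =
  c a b *: fib_map F (in_interval (J b) i) (in_interval (K a) i) x.

(** The bar J b survives a shift by n, so the composite of Phi with [psi] has a nonzero diagonal
    entry at b. Some K a carries it, and the entry of [psi] from K a back to J b bounds the upper
    ends. *)
Lemma long_column b : (lo (J b) + n <= hi (J b))%N ->
  exists2 a, c a b != 0 & (hi (J b) <= hi (K a) + n)%N.
Proof.
case: goodPhi => -[psi psiN psiP] _ _ long.
have [x x0] := exists_gen F (J b).
have lt : (lo (J b) + n < l.+1)%N := leq_ltn_trans long (ltn_ord _).
pose i' := Ordinal lt; have h : (lo (J b) <= i')%N := leq_addr _ _.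
have [H _] := psiP _ i' h erefl.
have : pV b i' (pm_map V h (iV b _ x)) != 0.
  rewrite mor_naturalE bb_inK interval_map_neq0 ?in_lo //.
  by rewrite /in_interval h.
rewrite -H -[X in psi _ _ X](bb_sum bW) !lfun_sum => nz.
have [a /negP Ha] : exists a,
    ~ (pV b i' (psi _ i' (iW a _ (pW a _ (Phi _ (iV b _ x))))) == 0).
  apply/existsNP => z; case/eqP: nz; apply: big1 => a _; exact/eqP.
exists a; last by have [] := shifted_entry psiN (erefl : i' = _ :> nat) Ha.
by apply: contraNneq Ha => c0; rewrite cE c0 scale0r !lfun0.
Qed.

(** Here the composite in the other order has a nonzero diagonal entry at a, and the entry of [psi]
    from K a to J b bounds the lower ends. *)
Lemma long_row a : (lo (K a) + n <= hi (K a))%N ->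
  exists2 b, c a b != 0 & (lo (J b) <= lo (K a) + n)%N.
Proof.
case: goodPhi => -[psi psiN psiP] _ _ long.
have [x x0] := exists_gen F (K a).
have lt : (lo (K a) + n < l.+1)%N := leq_ltn_trans long (ltn_ord _).
pose i' := Ordinal lt; have h : (lo (K a) <= i')%N := leq_addr _ _.
have [_ H] := psiP _ i' h erefl.
have : pW a i' (pm_map W h (iW a _ x)) != 0.
  rewrite mor_naturalE bb_inK interval_map_neq0 ?in_lo //.
  by rewrite /in_interval h.
rewrite -H -[X in Phi _ X](bb_sum bV) !lfun_sum => nz.
have [b /negP Hb] : exists b,
    ~ (pW a i' (Phi i' (iV b _ (pV b _ (psi _ i' (iW a _ x))))) == 0).
  apply/existsNP => z; case/eqP: nz; apply: big1 => b _; exact/eqP.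
exists b; first by apply: contraNneq Hb => c0; rewrite cE c0 scale0r.
have nz' : pV b i' (psi _ i' (iW a _ x)) != 0.
  by apply: contraNneq Hb => ->; rewrite !lfun0.
by have [] := shifted_entry psiN (erefl : i' = _ :> nat) nz'.
Qed.

(* Row a0 has the largest bar by (hi, lo) among the nonzero rows, column b0
   the smallest bar by (lo, hi) in that row. *)
Lemma exists_pivot : (exists a b, c a b != 0) ->
  exists a0 b0, [/\ c a0 b0 != 0,
    forall b, c a0 b != 0 -> preceq (J b0) (J b) &
    forall a, c a b0 != 0 -> preceq (K a) (K a0)].
Proof.
case=> a1 [b1 c1].
pose P a := [exists b, c a b != 0].
have P1 : P a1 by apply/existsP; exists b1.
case: (arg_maxnP (fun a => hi (K a) * l.+1 + lo (K a))%N P1) => a0 P0 max0.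
have {}max0 a b : c a b != 0 ->
    (hi (K a) < hi (K a0))%N \/
    hi (K a) = hi (K a0) :> nat /\ (lo (K a) <= lo (K a0))%N.
  move=> cab; have Pa : P a by apply/existsP; exists b.
  exact: lex_le (ltn_ord _) (ltn_ord _) (max0 a Pa).
have [b2 c2] := existsP P0.
case: (@arg_minnP _ b2 (fun b => c a0 b != 0)
        (fun b => lo (J b) * l.+1 + hi (J b))%N c2) => b0 c0 min0.
have {}min0 b : c a0 b != 0 ->
    (lo (J b0) < lo (J b))%N \/
    lo (J b0) = lo (J b) :> nat /\ (hi (J b0) <= hi (J b))%N.
  move=> cab; exact: lex_le (ltn_ord _) (ltn_ord _) (min0 b cab).
have sJ b : summand (J b) V by exists (iV b), (pV b); apply: bb_inK.
have sK a : summand (K a) W by exists (iW a), (pW a); apply: bb_inK.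
have [_ gapV gapW] := goodPhi.
exists a0, b0; split=> // [b cb|a ca].
  have /and3P[p1 p2 p3] := c_preceq c0; have /and3P[q1 q2 q3] := c_preceq cb.
  have lohi : (lo (J b0) <= hi (J b0))%N := valP (J b0).
  have lohi' : (lo (J b) <= hi (J b))%N := valP (J b).
  have [lt|[e le]] := min0 _ cb; last by rewrite /preceq; lia.
  (* The two bars intersect because lo (J b) <= hi (K a0) <= hi (J b0); only the order of the upper
     ends is open. *)
  case: (leqP (hi (J b0)) (hi (J b))) => [le|nst].
    by rewrite /preceq; lia.
  have nst' : nested (J b) (J b0) by rewrite /nested lt lohi' nst.
  have [g1 g2] := gapV _ _ (sJ b) (sJ b0) nst'.
  (* The gap makes J b0 long. The row found has hi (J b0) <= hi (K a) + n <= hi (K a0) + n <= hi (J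
     b) + n, against the gap. *)
  have [|a ca la] := @long_column b0; first by lia.
  by have [] := max0 _ _ ca; lia.
have /and3P[p1 p2 p3] := c_preceq c0; have /and3P[q1 q2 q3] := c_preceq ca.
have lohi : (lo (K a0) <= hi (K a0))%N := valP (K a0).
have lohi' : (lo (K a) <= hi (K a))%N := valP (K a).
have [lt|[e le]] := max0 _ _ ca; last by rewrite /preceq; lia.
case: (leqP (lo (K a)) (lo (K a0))) => [le|nst]; first by rewrite /preceq; lia.
have nst' : nested (K a) (K a0) by rewrite /nested nst lohi' lt.
have [g1 g2] := gapW _ _ (sK a) (sK a0) nst'.
(* Symmetrically lo (J b0) <= lo (J b) <= lo (K a0) + n < lo (K a), whereas c a b0 != 0 gives lo (K
   a) <= lo (J b0). *)
have [|b cb lb] := @long_row a0; first by lia.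
by have [] := min0 _ cb; lia.
Qed.

End Pivot.

Section RhoSummand.
Variables (F : fieldType) (l n : nat) (V W : persmod F l) (Phi : pm_mor V W).
Local Notation IM := (@interval_module F l).

(* Column b0 and row a0 of the matrix of Phi factor through rho, because
   K a <= K a0 <= J b0 and K a0 <= J b0 <= J b wherever their entries are
   nonzero; so both combine into a retract of Phi. *)
Lemma exists_rho_summand : good n (Ladder Phi) ->
  (exists i x, Phi i x != 0) ->
  exists (J K : interval l) (h : preceq K J)
    (fv : pm_mor (IM J) V) (gv : pm_mor V (IM J))
    (fw : pm_mor (IM K) W) (gw : pm_mor W (IM K)),
  [/\ retract fv gv, retract fw gw,
      forall i x, Phi i (fv i x) = fw i (rho F h i x) &
      forall i x, rho F h i (gv i x) = gw i (Phi i x)].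
Proof.
move=> goodPhi Phi_neq0.
have [bV] := exists_bar_basis V; have [bW] := exists_bar_basis W.
pose J := @bb_bar _ _ _ bV; pose K := @bb_bar _ _ _ bW.
pose iV := @bb_in _ _ _ bV; pose pV := @bb_out _ _ _ bV.
pose iW := @bb_in _ _ _ bW; pose pW := @bb_out _ _ _ bW.
have H ab : exists c : F, (c != 0 -> preceq (K ab.1) (J ab.2)) /\
    forall i x, pW ab.1 i (Phi i (iV ab.2 i x)) =
      c *: fib_map F (in_interval (J ab.2) i) (in_interval (K ab.1) i) x.
  have [c [c1 c2]] :=
    interval_mor_scalar (comp_mor (pW ab.1) (comp_mor Phi (iV ab.2))).
  by exists c; split=> // i x; rewrite -c2 !comp_morE.
have [c' c'P] := choice H.
pose c a b := c' (a, b).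
have cP a b : c a b != 0 -> preceq (K a) (J b) by case: (c'P (a, b)).
have cE a b i x : pW a i (Phi i (iV b i x)) =
    c a b *: fib_map F (in_interval (J b) i) (in_interval (K a) i) x.
  by case: (c'P (a, b)).
have [a0 [b0 [c0 row0 col0]]] : exists a0 b0, [/\ c a0 b0 != 0,
    forall b, c a0 b != 0 -> preceq (J b0) (J b) &
    forall a, c a b0 != 0 -> preceq (K a) (K a0)].
  apply: (exists_pivot goodPhi cP cE); apply: contrapT => z.
  case: Phi_neq0 => i [x /eqP[]].
  rewrite -[x](bb_sum bV) lfun_sum big1 // => b _.
  rewrite -[LHS](bb_sum bW) big1 // => a _.
  have c0 : c a b = 0.
    by apply/eqP/negPn/negP => cab; apply: z; exists a, b.
  by rewrite [X in bb_in _ _ X]cE c0 scale0r lfun0.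
have hP := cP _ _ c0.
(* On V the inclusion is that of bar b0 and the retraction collects row a0; on W the inclusion
   collects column b0 and the retraction projects to bar a0. The inverse of the pivot entry in both
   retractions makes the two composites the identity. *)
exists (J b0), (K a0), hP, (iV b0),
  (lincomb_mor (fun b => (c a0 b0)^-1 * c a0 b)
     (fun b => comp_mor (rho_or_0 F (J b0) (J b)) (pV b))),
  (lincomb_mor (fun a => c a b0)
     (fun a => comp_mor (iW a) (rho_or_0 F (K a) (K a0)))),
  (scale_mor (c a0 b0)^-1 (pW a0)); split=> i x.
- rewrite lincomb_morE (big_only1 b0) // => [|b bb0 _].
    rewrite mulVf // scale1r comp_morE bb_inK.
    by rewrite rho_or_0E ?preceq_refl // fib_map_idE.
  by rewrite comp_morE bb_ortho // lfun0 scaler0.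
- rewrite scale_morE lincomb_morE lfun_sum (big_only1 a0) // => [|a aa0 _].
    rewrite lfunZ scalerA mulVf // scale1r comp_morE bb_inK.
    by rewrite rho_or_0E ?preceq_refl // fib_map_idE.
  by rewrite lfunZ comp_morE bb_ortho ?scaler0 // eq_sym.
- rewrite -[LHS](bb_sum bW) lincomb_morE; apply: eq_bigr => a _.
  rewrite [X in bb_in _ _ X]cE lfunZ comp_morE.
  have [->|ca] := eqVneq (c a b0) 0; first by rewrite !scale0r.
  by rewrite rho_or_0E ?col0 // rho_trans ?col0.
- rewrite scale_morE lincomb_morE lfun_sum -[x in RHS](bb_sum bV) !lfun_sum.
  rewrite scaler_sumr; apply: eq_bigr => b _.
  rewrite [pW a0 i _]cE lfunZ comp_morE scalerA.
  have [->|cb] := eqVneq (c a0 b) 0; first by rewrite mulr0 !scale0r.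
  by rewrite rho_or_0E ?row0 // rho_trans ?row0.
Qed.

End RhoSummand.

(** * Assembling the decomposition *)

Section NormalForms.
Variables (F : fieldType) (l : nat).
Implicit Types (L M : ladder F l) (J K : interval l) (p : preceq_pair l).

Definition decomposable L : Prop :=
  exists (r : preceq_pair l -> nat) (dplus dminus : interval l -> nat),
    lad_iso L
      (lad_sum
        (lad_sum
          (lad_bigsum (fun p => lad_pow (lad_R F (valP p)) (r p)))
          (lad_bigsum (fun J => lad_pow (lad_Iplus F J) (dplus J))))
        (lad_bigsum (fun K => lad_pow (lad_Iminus F K) (dminus K)))).

Lemma decomposable_iso L M : lad_iso L M -> decomposable M -> decomposable L.
Proof.
move=> LM [r [dp [dm H]]]; exists r, dp, dm; exact: lad_iso_trans LM H.
Qed.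

Lemma decomposable_zero : decomposable (lad_zero F l).
Proof.
have z := eqv_big0 (@lad_iso_refl F l) (@lad_iso_trans F l) (@lad_iso_add0 F l).
exists (fun=> 0%N), (fun=> 0%N), (fun=> 0%N); apply: lad_iso_sym.
apply: lad_iso_trans (lad_iso_add0 _).
apply: lad_iso_sum (z _ _).
apply: lad_iso_trans (lad_iso_add0 _).
exact: lad_iso_sum (z _ _) (z _ _).
Qed.

Lemma lad_bigsum_incr (I : finType) (X : I -> ladder F l) (r : I -> nat) i0 :
  lad_iso (lad_sum (X i0) (lad_bigsum (fun i => lad_pow (X i) (r i))))
          (lad_bigsum (fun i => lad_pow (X i) ((i == i0) + r i)%N)).
Proof.
apply: lad_iso_sym.
exact: (eqv_big_incr (lad_zero F l) (@lad_iso_refl F l) (@lad_iso_sym F l)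
  (@lad_iso_trans F l) (@lad_iso_sum F l) (@lad_iso_assoc F l)
  (@lad_iso_swap F l)).
Qed.

Lemma lad_iso_CA L M N :
  lad_iso (lad_sum L (lad_sum M N)) (lad_sum M (lad_sum L N)).
Proof.
exact: (eqv_CA (@lad_iso_refl F l) (@lad_iso_sym F l)
  (@lad_iso_trans F l) (@lad_iso_sum F l) (@lad_iso_assoc F l)
  (@lad_iso_swap F l)).
Qed.

Lemma decomposable_R p L :
  decomposable L -> decomposable (lad_sum (lad_R F (valP p)) L).
Proof.
case=> r [dp [dm H]]; exists (fun q => (q == p) + r q)%N, dp, dm.
apply: lad_iso_trans (lad_iso_sum (lad_iso_refl _) H) _.
apply: lad_iso_trans (lad_iso_assoc _ _ _) _.
apply: lad_iso_sum (lad_iso_refl _).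
apply: lad_iso_trans (lad_iso_assoc _ _ _) _.
apply: lad_iso_sum (lad_iso_refl _).
exact: (lad_bigsum_incr (fun q : preceq_pair l => lad_R F (valP q)) r p).
Qed.

Lemma decomposable_Iplus J L :
  decomposable L -> decomposable (lad_sum (lad_Iplus F J) L).
Proof.
case=> r [dp [dm H]]; exists r, (fun I => (I == J) + dp I)%N, dm.
apply: lad_iso_trans (lad_iso_sum (lad_iso_refl _) H) _.
apply: lad_iso_trans (lad_iso_assoc _ _ _) _.
apply: lad_iso_sum (lad_iso_refl _).
apply: lad_iso_trans (lad_iso_CA _ _ _) _.
apply: lad_iso_sum (lad_iso_refl _) _.
exact: (lad_bigsum_incr (@lad_Iplus F l) dp J).
Qed.

Lemma decomposable_Iminus K L :
  decomposable L -> decomposable (lad_sum (lad_Iminus F K) L).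
Proof.
case=> r [dp [dm H]]; exists r, dp, (fun I => (I == K) + dm I)%N.
apply: lad_iso_trans (lad_iso_sum (lad_iso_refl _) H) _.
apply: lad_iso_trans (lad_iso_CA _ _ _) _.
apply: lad_iso_sum (lad_iso_refl _) _.
exact: (lad_bigsum_incr (@lad_Iminus F l) dm K).
Qed.

Lemma good_decomposable n L : good n L -> decomposable L.
Proof.
have [m] := ubnP (lad_dim L); elim: m L => // m IH [V W Phi].
rewrite ltnS => dimL goodL.
(* The zero module is a retract of every module; it supplies the empty side of [lad_Iplus] and
   [lad_Iminus]. *)
have retract0 U : retract (zero_mor (pm_zero F l) U) (zero_mor U _).
  by move=> i x; rewrite [RHS]pm_zero_eq0; apply: zero_morE.
case: (pselect (exists i x, Phi i x != 0)) => [Phi_neq0|Phi0].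
  have [J [K [h [fv [gv [fw [gw [fvK fwK fvw gvw]]]]]]]] :=
    exists_rho_summand goodL Phi_neq0.
  pose p : preceq_pair l := exist _ (K, J) h.
  have nz : exists i (x : interval_module F J i), x != 0.
    by have [x x0] := exists_gen F J; exists (lo J), x.
  have [L' [iL' gL' dL']] :=
    @lad_split _ _ _ (Ladder Phi) (lad_R F h) _ _ _ _ fvK fwK fvw gvw
      (or_introl nz) goodL.
  (* [lad_R] takes the proof of [preceq] as an argument, so [h] is exchanged for the one attached to
     [p]. *)
  apply: decomposable_iso iL' _; rewrite -(bool_irrelevance (valP p) h).
  apply/(@decomposable_R p)/IH => //; exact: leq_trans dL' dimL.
have {}Phi0 i x : Phi i x = 0.
  by apply/eqP/negPn/negP => nz; apply: Phi0; exists i, x.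
case: (pselect (exists i (x : V i), x != 0)) => [[i [x x0]]|V0].
  have [J [f [g fK]]] := exists_summand x0.
  have nz : exists i (x : interval_module F J i), x != 0.
    by have [y y0] := exists_gen F J; exists (lo J), y.
  have [||L' [iL' gL' dL']] :=
    @lad_split _ _ _ (Ladder Phi) (lad_Iplus F J) f g _ _ fK (retract0 W) _ _
      (or_introl nz) goodL.
  - by move=> j y; rewrite [LHS]Phi0 [RHS]zero_morE.
  - by move=> j y; rewrite [LHS]zero_morE [RHS]zero_morE.
  apply: decomposable_iso iL' _; apply/decomposable_Iplus/IH => //.
  exact: leq_trans dL' dimL.
case: (pselect (exists i (x : W i), x != 0)) => [[i [x x0]]|W0].
  have [K [f [g fK]]] := exists_summand x0.
  have nz : exists i (x : interval_module F K i), x != 0.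
    by have [y y0] := exists_gen F K; exists (lo K), y.
  have [||L' [iL' gL' dL']] :=
    @lad_split _ _ _ (Ladder Phi) (lad_Iminus F K) _ _ f g (retract0 V) fK _ _
      (or_intror nz) goodL.
  - by move=> j y; rewrite [LHS]Phi0 [X in f _ X]zero_morE lfun0.
  - by move=> j y; rewrite [LHS]zero_morE [X in g _ X]Phi0 lfun0.
  apply: decomposable_iso iL' _; apply/decomposable_Iminus/IH => //.
  exact: leq_trans dL' dimL.
apply: decomposable_iso decomposable_zero.
have z U : ~ (exists i (x : pm_obj U i), x != 0) ->
    is_iso (zero_mor U (pm_zero F l)).
  move=> U0; apply: is_iso_to0 => i x.
  by apply/eqP/negPn/negP => nz; apply: U0; exists i, x.
apply: (@lad_isoP _ _ (Ladder Phi) (lad_zero F l) _ _ (z _ V0) (z _ W0)).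
by move=> i x; rewrite [RHS]zero_morE; apply: zero_morE.
Qed.

End NormalForms.

(** Nested summands are bars, so their [nest_gap] is one of the terms whose minimum is [Xi V];
    nestedness fixes the signs inside the absolute values. *)
Lemma Xi_gapped (F : fieldType) (l n : nat) (V : persmod F l) :
  ((n%:R)%:E < Xi V)%E -> gapped n V.
Proof.
move=> nXi J K /summand_Bar BJ /summand_Bar BK nJK.
have : (Xi V <= (nest_gap J K)%:E)%E.
  by apply: (@bigmin_le_cond _ _ _ _ (J, K)); rewrite BJ BK.
move=> /(lt_le_trans nXi); rewrite lte_fin /nest_gap lt_min => /andP[].
case/and3P: nJK => lt1 _ lt2.
move=> g1 g2; split.
  by move: g1; rewrite gtr0_norm ?subr_gt0 ?ltr_nat // ltrBrDl -natrD ltr_nat.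
move: g2; rewrite ltr0_norm ?subr_lt0 ?ltr_nat // opprB ltrBrDl -natrD.
by rewrite ltr_nat.
Qed.

Lemma lt_half_min (n : nat) (delta : rat) (x y : \bar rat) :
  n%:R = 2 * delta -> (delta%:E < (2^-1)%:E * Order.min x y)%E ->
  ((n%:R)%:E < x)%E /\ ((n%:R)%:E < y)%E.
Proof.
move=> nE lt; suff : ((n%:R)%:E < Order.min x y)%E.
  by rewrite lt_min => /andP.
(* The minimum is finite, +oo or -oo; in the last case the product is -oo, so the hypothesis is
   contradictory. *)
case: (Order.min x y) lt => [r| |].
- by rewrite -EFinM !lte_fin nE; lra.
- by move=> _; rewrite ltry.
- by rewrite gt0_muleNy // lte_fin invr_gt0.
Qed.

Unset Implicit Arguments.

Theorem theorem3p10 (F : fieldType) (l : nat) (V W : persmod F l)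
    (Phi : pm_mor V W) (delta : rat) (delta_ge0 : 0 <= delta)
    (Phi_inv : delta_invertible delta Phi)
    (delta_small : (delta%:E < (2^-1)%:E * Order.min (Xi V) (Xi W))%E) :
  exists (r : preceq_pair l -> nat) (dplus dminus : interval l -> nat),
    lad_iso (Ladder Phi)
      (lad_sum
        (lad_sum
          (lad_bigsum (fun p : preceq_pair l => lad_pow (lad_R F (valP p)) (r p)))
          (lad_bigsum (fun J : interval l => lad_pow (lad_Iplus F J) (dplus J))))
        (lad_bigsum (fun K : interval l => lad_pow (lad_Iminus F K) (dminus K)))).
Proof.
(* Here n = 2 delta, so the bound on delta says that n lies below both [Xi V] and [Xi W]. *)
have [n nE _] := Phi_inv.
have [nV nW] := lt_half_min nE delta_small.
apply: (@good_decomposable F l n); split; [|exact: Xi_gapped|exact: Xi_gapped].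
exact: delta_invertible_shift nE Phi_inv.
Qed.
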